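(* Let $\Bbbk$ be a field of characteristic zero. For a pre-Lie algebra $L$ over $\Bbbk$, let $U_{\mathrm{PreLie}}(L)$ denote its universal multiplicative enveloping algebra. Then there is a vector space isomorphism $$U_{\mathrm{PreLie}}(L)\cong T(L)\otimes S(L),$$ where $T(L)=\bigoplus_{n\ge 0}L^{\otimes n}$ and $S(L)=\bigoplus_{n\ge 0}S^n(L)$ are the underlying vector spaces of the tensor algebra and the symmetric algebra of the vector space $L$. Moreover, these isomorphisms can be chosen in a way that is natural with respect to pre-Lie algebra morphisms, i.e. the functors $L\mapsto U_{\mathrm{PreLie}}(L)$ and $L\mapsto T(L)\otimes S(L)$ from pre-Lie algebras to vector spaces are naturally isomorphic.
   Context: A pre-Lie (right-symmetric) algebra is a vector space $L$ with a bilinear operation $\triangleleft$ satisfying $(a_1\triangleleft a_2)\triangleleft a_3 - a_1\triangleleft (a_2\triangleleft a_3)=(a_1\triangleleft a_3)\triangleleft a_2 - a_1\triangleleft (a_3\triangleleft a_2)$. A (operadic) module over $L$ is a vector space $E$ with bilinear maps $L\times E\to E$, $(a,e)\mapsto a\triangleleft e$, and $E\times L\to E$, $(e,a)\mapsto e\triangleleft a$, such that $L\oplus E$, with the product extending that of $L$ by these maps and by $E\triangleleft E=0$, is a pre-Lie algebra. The universal multiplicative enveloping algebra $U_{\mathrm{PreLie}}(L)$ is the unital associative algebra whose category of left modules is equivalent (compatibly with underlying vector spaces) to the category of $L$-modules. Explicitly, it is generated by symbols $l_a,r_a$ depending linearly on $a\in L$ (acting on a module by $l_a(e)=a\triangleleft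 e$, $r_a(e)=e\triangleleft a$), subject to the relations $r_br_a-r_{a\triangleleft b}=r_ar_b-r_{b\triangleleft a}$ and $r_bl_a-l_ar_b=l_{a\triangleleft b}-l_al_b$ for all $a,b\in L$. A morphism $f\colon L\to L'$ induces the algebra morphism $l_a\mapsto l_{f(a)}$, $r_a\mapsto r_{f(a)}$. *)

(* Defs.v *)
From HB Require Import structures.
From mathcomp Require Import all_boot all_order all_algebra all_fingroup.
From mathcomp Require Import generic_quotient ring_quotient finmap.
From mathcomp Require Import boolp.
From mathcomp.multinomials Require Import monalg.

Set Implicit Arguments.
Unset Strict Implicit.
Unset Printing Implicit Defensive.

Import GRing.Theory.
Local Open Scope ring_scope.
Local Open Scope quotient_scope.

Record subspace (k : fieldType) (V : lmodType k) := Subspace {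
  subspace_pred :> {pred V};
  subspace_closed : submod_closed subspace_pred
}.

HB.instance Definition _ (k : fieldType) (V : lmodType k) (S : subspace V) :=
  GRing.isZmodClosed.Build V (subspace_pred S)
    (GRing.submod_closedB (subspace_closed S)).

Definition subspace_zmod (k : fieldType) (V : lmodType k) (S : subspace V) :
  zmodClosed V := GRing.ZmodClosed.clone V (subspace_pred S) _.

Section LmodQuotient.
Variables (k : fieldType) (V : lmodType k) (S : subspace V).

Definition lquot := Quotient.quot (subspace_zmod S).

HB.instance Definition _ := GRing.Zmodule.on lquot.

Definition lproj (v : V) : lquot := \pi_(Quotient.quot (subspace_zmod S)) v.

Lemma lproj_surj (x : lquot) : exists v, x = lproj v.
Proof. by exists (repr x); rewrite /lproj reprK. Qed.

Lemma lproj_eq (u v : V) : lproj u = lproj v <-> u - v \in S.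
Proof.
rewrite /lproj; split=> [e|h]; first by rewrite Quotient.idealrBE; apply/eqP.
by apply/eqP; rewrite -Quotient.idealrBE.
Qed.

Fact lproj_is_zmod_morphism : zmod_morphism lproj.
Proof. by move=> u v; rewrite /lproj raddfB. Qed.

HB.instance Definition _ :=
  GRing.isZmodMorphism.Build V lquot lproj lproj_is_zmod_morphism.

Definition lquot_scale (c : k) (x : lquot) : lquot :=
  lproj (c *: repr (x : Quotient.quot (subspace_zmod S))).

Lemma lquot_scaleE c v : lquot_scale c (lproj v) = lproj (c *: v).
Proof.
apply/lproj_eq; rewrite -scalerBr -[_ *: _]addr0; case: (subspace_closed S) => S0; apply=> //.
by apply/lproj_eq; rewrite /lproj reprK.
Qed.

Fact lquot_scaleA a b x :
  lquot_scale a (lquot_scale b x) = lquot_scale (a * b) x.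
Proof. by have [v ->] := lproj_surj x; rewrite !lquot_scaleE scalerA. Qed.

Fact lquot_scale1 : left_id 1 lquot_scale.
Proof.
by move=> x; have [v ->] := lproj_surj x; rewrite lquot_scaleE scale1r.
Qed.

Fact lquot_scaleDr : right_distributive lquot_scale +%R.
Proof.
move=> c x y; have [u ->] := lproj_surj x; have [v ->] := lproj_surj y.
by rewrite -raddfD !lquot_scaleE scalerDr raddfD.
Qed.

Fact lquot_scaleDl x : {morph lquot_scale^~ x : a b / a + b}.
Proof.
move=> a b; have [v ->] := lproj_surj x.
by rewrite !lquot_scaleE scalerDl raddfD.
Qed.

HB.instance Definition _ := GRing.Zmodule_isLmodule.Build k lquot
  lquot_scaleA lquot_scale1 lquot_scaleDr lquot_scaleDl.

Fact lproj_is_scalable : scalable lproj.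
Proof. by move=> c v; rewrite -lquot_scaleE. Qed.

HB.instance Definition _ :=
  GRing.isScalable.Build k V lquot *:%R lproj lproj_is_scalable.

Section Lift.
Variables (W : lmodType k) (f : {linear V -> W}).
Hypothesis fS : forall v, v \in S -> f v = 0.

Definition lquot_lift_fun of (forall v, v \in S -> f v = 0) :=
  fun x : lquot => f (repr (x : Quotient.quot (subspace_zmod S))).

Lemma lquot_lift_funE v : lquot_lift_fun fS (lproj v) = f v.
Proof.
apply/eqP; rewrite -subr_eq0 /lquot_lift_fun -raddfB; apply/eqP/fS.
by apply/lproj_eq; rewrite /lproj reprK.
Qed.

Fact lquot_lift_is_linear : linear (lquot_lift_fun fS).
Proof.
move=> c x y; have [u ->] := lproj_surj x; have [v ->] := lproj_surj y.
by rewrite -linearP !lquot_lift_funE linearP.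
Qed.

HB.instance Definition _ := GRing.isLinear.Build k lquot W *:%R
  (lquot_lift_fun fS) lquot_lift_is_linear.

Definition lquot_lift : {linear lquot -> W} := lquot_lift_fun fS.

Lemma lquot_liftE v : lquot_lift (lproj v) = f v.
Proof. exact: lquot_lift_funE. Qed.

End Lift.
End LmodQuotient.

Section Span.
Variables (k : fieldType) (V : lmodType k) (R : V -> Prop).

Inductive in_span : V -> Prop :=
| in_span_gen v : R v -> in_span v
| in_span0 : in_span 0
| in_spanP c u v : in_span u -> in_span v -> in_span (c *: u + v).

Fact in_span_submod_closed : submod_closed [pred v | `[< in_span v >]].
Proof.
split=> [|c u v]; rewrite !inE; first by apply/asboolP/in_span0.
by move=> /asboolP hu /asboolP hv; apply/asboolP/in_spanP.
Qed.

Definition lspan : subspace V := Subspace in_span_submod_closed.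

Lemma lspan_gen v : R v -> v \in lspan.
Proof. by move=> Rv; rewrite inE; apply/asboolP/in_span_gen. Qed.

Lemma lspan_kill (W : lmodType k) (f : {linear V -> W}) :
  (forall v, R v -> f v = 0) -> forall v, v \in lspan -> f v = 0.
Proof.
move=> fR v; rewrite inE => /asboolP; elim=> {v} [v /fR//||c u v _ hu _ hv].
  exact: linear0.
by rewrite linearP hu hv scaler0 addr0.
Qed.

End Span.

Section FreeLift.
Variables (k : fieldType) (X : choiceType) (W : lmodType k) (h : X -> W).

(* {malg k[X]} is the vector space with basis X, and << x >> its basis       *)
(* vector at x.                                                              *)
Definition free_lift_fun (g : {malg k[X]}) : W :=
  \sum_(x <- msupp g) g@_x *: h x.

Lemma free_lift_funEw (d : {fset X}) g : (msupp g `<=` d)%fset ->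
  free_lift_fun g = \sum_(x <- d) g@_x *: h x.
Proof.
move=> le; rewrite /free_lift_fun (big_fset_incl _ le) //= => x _ xg.
by rewrite mcoeff_outdom // scale0r.
Qed.

Fact free_lift_is_linear : linear free_lift_fun.
Proof.
move=> c g1 g2; pose d := (msupp (c *: g1 + g2) `|` msupp g1 `|` msupp g2)%fset.
rewrite !(@free_lift_funEw d) ?fsubsetUr //; first last.
- by rewrite /d -fsetUA fsubsetUl.
- by rewrite /d fsetUAC fsubsetUr.
rewrite scaler_sumr -big_split /=; apply: eq_bigr => x _.
by rewrite mcoeffD mcoeffZ scalerDl scalerA.
Qed.

HB.instance Definition _ := GRing.isLinear.Build k {malg k[X]} W *:%R
  free_lift_fun free_lift_is_linear.

Definition free_lift : {linear {malg k[X]} -> W} := free_lift_fun.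

Lemma free_liftU x : free_lift << x >> = h x.
Proof.
rewrite /free_lift /= (@free_lift_funEw [fset x]%fset) ?msuppU_le //.
by rewrite big_seq_fset1 mcoeffUU scale1r.
Qed.

End FreeLift.

Section Tensor.
Variables (k : fieldType) (V W : lmodType k).

Inductive tens_rel : {malg k[(V * W)%type]} -> Prop :=
| tens_relPl c v1 v2 w :
    tens_rel (<< (c *: v1 + v2, w) >> - (c *: << (v1, w) >> + << (v2, w) >>))
| tens_relPr c v w1 w2 :
    tens_rel (<< (v, c *: w1 + w2) >> - (c *: << (v, w1) >> + << (v, w2) >>)).

Definition tens := lquot (lspan tens_rel).
HB.instance Definition _ := GRing.Lmodule.on tens.

Definition tpure (v : V) (w : W) : tens := lproj (lspan tens_rel) << (v, w) >>.

Lemma tpurePl c v1 v2 w :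
  tpure (c *: v1 + v2) w = c *: tpure v1 w + tpure v2 w.
Proof. by rewrite /tpure -linearP; apply/lproj_eq/lspan_gen/tens_relPl. Qed.

Lemma tpurePr c v w1 w2 :
  tpure v (c *: w1 + w2) = c *: tpure v w1 + tpure v w2.
Proof. by rewrite /tpure -linearP; apply/lproj_eq/lspan_gen/tens_relPr. Qed.

Section Lift.
Variables (E : lmodType k) (h : V -> W -> E).
Hypothesis hl : forall w, linear (h^~ w).
Hypothesis hr : forall v, linear (h v).

Fact tens_lift_kill g : g \in lspan tens_rel ->
  free_lift (fun x : (V * W)%type => h x.1 x.2) g = 0.
Proof.
move: g; apply: lspan_kill => _ [c v1 v2 w|c v w1 w2];
by rewrite linearB linearP !free_liftU /= ?hl ?hr subrr.
Qed.

Definition tens_lift : {linear tens -> E} := lquot_lift tens_lift_kill.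

Lemma tens_liftE v w : tens_lift (tpure v w) = h v w.
Proof. by rewrite /tens_lift lquot_liftE free_liftU. Qed.

End Lift.
End Tensor.

Section TensorMap.
Variables (k : fieldType) (V V' W W' : lmodType k).
Variables (f : {linear V -> V'}) (g : {linear W -> W'}).

Fact tens_map_linearl w : linear (fun v => tpure (f v) (g w)).
Proof. by move=> c v1 v2; rewrite linearP tpurePl. Qed.

Fact tens_map_linearr v : linear (fun w => tpure (f v) (g w)).
Proof. by move=> c w1 w2; rewrite linearP tpurePr. Qed.

Definition tens_map : {linear tens V W -> tens V' W'} :=
  tens_lift tens_map_linearl tens_map_linearr.

Lemma tens_mapE v w : tens_map (tpure v w) = tpure (f v) (g w).
Proof. exact: tens_liftE. Qed.

End TensorMap.

Section TensorPower.
Variables (k : fieldType) (n : nat) (V : lmodType k).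

Definition subst_at (w : {ffun 'I_n -> V}) (i : 'I_n) (a : V) :
  {ffun 'I_n -> V} := [ffun j => if j == i then a else w j].

(* The n-th tensor power, presented by the n-fold multilinearity relations.  *)
Inductive tpow_rel : {malg k[{ffun 'I_n -> V}]} -> Prop :=
| tpow_relP w i c a b :
    tpow_rel (<< subst_at w i (c *: a + b) >>
              - (c *: << subst_at w i a >> + << subst_at w i b >>)).

Definition tpow := lquot (lspan tpow_rel).
HB.instance Definition _ := GRing.Lmodule.on tpow.

Definition pow_pure (w : {ffun 'I_n -> V}) : tpow := lproj (lspan tpow_rel) << w >>.

Lemma pow_pureP w i c a b :
  pow_pure (subst_at w i (c *: a + b))
  = c *: pow_pure (subst_at w i a) + pow_pure (subst_at w i b).
Proof. by rewrite /pow_pure -linearP; apply/lproj_eq/lspan_gen/tpow_relP. Qed.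

Section Lift.
Variables (E : lmodType k) (h : {ffun 'I_n -> V} -> E).
Hypothesis hlin : forall w i, linear (fun a => h (subst_at w i a)).

Fact tpow_lift_kill g : g \in lspan tpow_rel -> free_lift h g = 0.
Proof.
move: g; apply: lspan_kill => _ [w i c a b].
by rewrite linearB linearP !free_liftU /= hlin subrr.
Qed.

Definition tpow_lift : {linear tpow -> E} := lquot_lift tpow_lift_kill.

Lemma tpow_liftE w : tpow_lift (pow_pure w) = h w.
Proof. by rewrite /tpow_lift lquot_liftE free_liftU. Qed.

End Lift.

(* S^n(V), as the coinvariants of the symmetric group acting on the n-th     *)
(* tensor power.                                                             *)
Inductive spow_rel : tpow -> Prop :=
| spow_relP (w : {ffun 'I_n -> V}) (s : 'S_n) :
    spow_rel (pow_pure [ffun j => w (s j)] - pow_pure w).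

Definition spow := lquot (lspan spow_rel).
HB.instance Definition _ := GRing.Lmodule.on spow.

Definition spow_pure (w : {ffun 'I_n -> V}) : spow :=
  lproj (lspan spow_rel) (pow_pure w).

Section SymLift.
Variables (E : lmodType k) (h : {ffun 'I_n -> V} -> E).
Hypothesis hlin : forall w i, linear (fun a => h (subst_at w i a)).
Hypothesis hsym : forall (w : {ffun 'I_n -> V}) (s : 'S_n), h [ffun j => w (s j)] = h w.

Fact spow_lift_kill g : g \in lspan spow_rel -> tpow_lift hlin g = 0.
Proof.
move: g; apply: lspan_kill => _ [w s].
by rewrite linearB !tpow_liftE hsym subrr.
Qed.

Definition spow_lift : {linear spow -> E} := lquot_lift spow_lift_kill.

Lemma spow_liftE w : spow_lift (spow_pure w) = h w.
Proof. by rewrite /spow_lift lquot_liftE tpow_liftE. Qed.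

End SymLift.
End TensorPower.

Section TensorPowerMap.
Variables (k : fieldType) (n : nat) (V V' : lmodType k) (f : {linear V -> V'}).

Definition map_word (w : {ffun 'I_n -> V}) : {ffun 'I_n -> V'} :=
  [ffun j => f (w j)].

Lemma map_word_subst w i a :
  map_word (subst_at w i a) = subst_at (map_word w) i (f a).
Proof. by apply/ffunP=> j; rewrite !ffunE; case: eqP. Qed.

Fact tpow_map_multilinear w i :
  linear (fun a => pow_pure (map_word (subst_at w i a))).
Proof. by move=> c a b; rewrite !map_word_subst linearP pow_pureP. Qed.

Definition tpow_map : {linear tpow n V -> tpow n V'} :=
  tpow_lift (h := fun w => pow_pure (map_word w)) tpow_map_multilinear.

Lemma tpow_mapE w : tpow_map (pow_pure w) = pow_pure (map_word w).
Proof. exact: tpow_liftE. Qed.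

Fact spow_map_multilinear w i :
  linear (fun a => spow_pure (map_word (subst_at w i a))).
Proof.
by move=> c a b; rewrite !map_word_subst linearP /spow_pure pow_pureP linearP.
Qed.

Fact spow_map_sym (w : {ffun 'I_n -> V}) (s : 'S_n) :
  spow_pure (map_word [ffun j => w (s j)]) = spow_pure (map_word w).
Proof.
have -> : map_word [ffun j => w (s j)] = [ffun j => map_word w (s j)].
  by apply/ffunP=> j; rewrite !ffunE.
by apply/lproj_eq/lspan_gen/spow_relP.
Qed.

Definition spow_map : {linear spow n V -> spow n V'} :=
  spow_lift (h := fun w => spow_pure (map_word w))
    spow_map_multilinear spow_map_sym.

Lemma spow_mapE w : spow_map (spow_pure w) = spow_pure (map_word w).
Proof. exact: spow_liftE. Qed.

End TensorPowerMap.

Section DirectSum.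
Variables (k : fieldType) (V : nat -> lmodType k).

Record dsum := DSum {
  dsum_val :> forall n, V n;
  dsum_fin : exists N, forall n, (N <= n)%N -> dsum_val n = 0
}.

HB.instance Definition _ := gen_eqMixin dsum.
HB.instance Definition _ := gen_choiceMixin dsum.

Lemma dsumP (x y : dsum) : (forall n, x n = y n) -> x = y.
Proof.
case: x y => [x hx] [y hy] /= h.
have e : x = y by exact: functional_extensionality_dep.
by subst y; congr DSum; exact: Prop_irrelevance.
Qed.

Fact dsum0_fin : exists N, forall n, (N <= n)%N -> (fun n => 0 : V n) n = 0.
Proof. by exists 0%N. Qed.

Fact dsumD_fin (x y : dsum) :
  exists N, forall n, (N <= n)%N -> (fun n => x n + y n) n = 0.
Proof.
have [[N hN] [M hM]] := (dsum_fin x, dsum_fin y); exists (maxn N M) => n.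
by rewrite geq_max => /andP[/hN -> /hM ->]; rewrite addr0.
Qed.

Fact dsumZ_fin (c : k) (x : dsum) :
  exists N, forall n, (N <= n)%N -> (fun n => c *: x n) n = 0.
Proof. by have [N hN] := dsum_fin x; exists N => n /hN ->; rewrite scaler0. Qed.

Definition dsum0 := DSum dsum0_fin.
Definition dsumD x y := DSum (dsumD_fin x y).
Definition dsumZ c x := DSum (dsumZ_fin c x).

Fact dsumDA : associative dsumD.
Proof. by move=> x y z; apply: dsumP => n /=; rewrite addrA. Qed.
Fact dsumDC : commutative dsumD.
Proof. by move=> x y; apply: dsumP => n /=; rewrite addrC. Qed.
Fact dsum0D : left_id dsum0 dsumD.
Proof. by move=> x; apply: dsumP => n /=; rewrite add0r. Qed.
Fact dsumND : left_inverse dsum0 (dsumZ (-1)) dsumD.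
Proof. by move=> x; apply: dsumP => n /=; rewrite scaleN1r addNr. Qed.

HB.instance Definition _ :=
  GRing.isZmodule.Build dsum dsumDA dsumDC dsum0D dsumND.

Fact dsumZA a b x : dsumZ a (dsumZ b x) = dsumZ (a * b) x.
Proof. by apply: dsumP => n /=; rewrite scalerA. Qed.
Fact dsumZ1 : left_id 1 dsumZ.
Proof. by move=> x; apply: dsumP => n /=; rewrite scale1r. Qed.
Fact dsumZDr : right_distributive dsumZ +%R.
Proof. by move=> c x y; apply: dsumP => n /=; rewrite scalerDr. Qed.
Fact dsumZDl x : {morph dsumZ^~ x : a b / a + b}.
Proof. by move=> a b; apply: dsumP => n /=; rewrite scalerDl. Qed.

HB.instance Definition _ :=
  GRing.Zmodule_isLmodule.Build k dsum dsumZA dsumZ1 dsumZDr dsumZDl.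

End DirectSum.

Section DirectSumMap.
Variables (k : fieldType) (V W : nat -> lmodType k).
Variable f : forall n, {linear V n -> W n}.

Fact dsum_map_fin (x : dsum V) :
  exists N, forall n, (N <= n)%N -> (fun n => f n (x n)) n = 0.
Proof. by have [N hN] := dsum_fin x; exists N => n /hN ->; rewrite linear0. Qed.

Definition dsum_map_fun x : dsum W := DSum (dsum_map_fin x).

Fact dsum_map_is_linear : linear dsum_map_fun.
Proof. by move=> c x y; apply: dsumP => n /=; rewrite linearP. Qed.

HB.instance Definition _ := GRing.isLinear.Build k (dsum V) (dsum W) *:%R
  dsum_map_fun dsum_map_is_linear.

Definition dsum_map : {linear dsum V -> dsum W} := dsum_map_fun.

End DirectSumMap.

Definition Tmod (k : fieldType) (V : lmodType k) := dsum (fun n => tpow n V).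
Definition Smod (k : fieldType) (V : lmodType k) := dsum (fun n => spow n V).
HB.instance Definition _ (k : fieldType) (V : lmodType k) :=
  GRing.Lmodule.on (Tmod V).
HB.instance Definition _ (k : fieldType) (V : lmodType k) :=
  GRing.Lmodule.on (Smod V).

Definition Tmod_map (k : fieldType) (V V' : lmodType k)
  (f : {linear V -> V'}) : {linear Tmod V -> Tmod V'} :=
  dsum_map (fun n => tpow_map n f).
Definition Smod_map (k : fieldType) (V V' : lmodType k)
  (f : {linear V -> V'}) : {linear Smod V -> Smod V'} :=
  dsum_map (fun n => spow_map n f).

Fact malg_scaleAr (R : comRingType) (K : monomType) (c : R)
  (x y : {malg R[K]}) : c *: (x * y) = x * (c *: y).
Proof.
apply/malgP=> m; rewrite [LHS]mcoeffZ [X in _ * X]mcoeffMl.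
rewrite [RHS](mcoeffMlw m (fsubset_refl _) (msuppZ_le c y)) mulr_sumr.
apply: eq_bigr => i _; rewrite mulr_sumr; apply: eq_bigr => j _.
by rewrite [in RHS]mcoeffZ mulrnAr mulrCA.
Qed.

(* {malg k[{fmonom X}]}, the monoid algebra of the free monoid on X, is the  *)
(* free associative algebra on X. Its multiplication is locked only to keep   *)
(* unification from unfolding it, and likewise for Umul below.                *)
HB.lock Definition falg_mul (k : fieldType) (X : choiceType)
  (x y : {malg k[{fmonom X}]}) : {malg k[{fmonom X}]} := x * y.

Definition falg (k : fieldType) (X : choiceType) := {malg k[{fmonom X}]}.

Section FreeAlgebra.
Variables (k : fieldType) (X : choiceType).

HB.instance Definition _ := GRing.Lmodule.on (falg k X).

Local Notation M := {malg k[{fmonom X}]}.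

Fact falg_mulA : associative (@falg_mul k X).
Proof. by move=> x y z; rewrite falg_mul.unlock mulrA. Qed.
Fact falg_mul1l : left_id (1 : M) (@falg_mul k X).
Proof. by move=> x; rewrite falg_mul.unlock mul1r. Qed.
Fact falg_mul1r : right_id (1 : M) (@falg_mul k X).
Proof. by move=> x; rewrite falg_mul.unlock mulr1. Qed.
Fact falg_mulDl : left_distributive (@falg_mul k X) +%R.
Proof. by move=> x y z; rewrite falg_mul.unlock mulrDl. Qed.
Fact falg_mulDr : right_distributive (@falg_mul k X) +%R.
Proof. by move=> x y z; rewrite falg_mul.unlock mulrDr. Qed.
Fact falg_1neq0 : (1 : M) != 0.
Proof. exact: oner_neq0. Qed.

HB.instance Definition _ := GRing.Zmodule_isNzRing.Build (falg k X)
  falg_mulA falg_mul1l falg_mul1r falg_mulDl falg_mulDr falg_1neq0.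

Fact falg_scaleAl (c : k) (x y : M) :
  c *: falg_mul x y = falg_mul (c *: x) y.
Proof. by rewrite falg_mul.unlock scalerAl. Qed.

HB.instance Definition _ :=
  GRing.Lmodule_isLalgebra.Build k (falg k X) falg_scaleAl.

Fact falg_scaleAr (c : k) (x y : M) :
  c *: falg_mul x y = falg_mul x (c *: y).
Proof. by rewrite falg_mul.unlock malg_scaleAr. Qed.

HB.instance Definition _ :=
  GRing.Lalgebra_isAlgebra.Build k (falg k X) falg_scaleAr.

Definition fgen (x : X) : falg k X := (<< fmu x >> : M).

Section Lift.
Variables (A : algType k) (h : X -> A).

Definition word_val (m : {fmonom X}) : A := \prod_(x <- (m : seq X)) h x.

Fact word_val_mmorphism : mmorphism word_val.
Proof.
split=> [m1 m2|]; rewrite /word_val.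
  by rewrite fmM big_cat.
by rewrite fm1 big_nil.
Qed.

HB.instance Definition _ :=
  isMultiplicative.Build {fmonom X} A word_val word_val_mmorphism.

Definition falg_lift_fun (g : falg k X) : A :=
  mmap (in_alg A) word_val (g : M).

Fact falg_lift_is_linear : linear falg_lift_fun.
Proof.
move=> c x y; rewrite /falg_lift_fun.
by rewrite [LHS](mmapD (c *: (x : M)) (y : M)) mmapZ /= mulr_algl.
Qed.

Fact falg_lift_is_monoid_morphism : monoid_morphism falg_lift_fun.
Proof.
have [hM h1] : multiplicative (mmap (in_alg A) word_val : M -> A).
  apply: commr_mmap_is_multiplicative => g m m'.
  by rewrite /GRing.comm /= mulr_algl mulr_algr.
split=> [|x y]; first exact: h1.
have -> : x * y = falg_mul x y by [].
by rewrite falg_mul.unlock /falg_lift_fun hM.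
Qed.

HB.instance Definition _ := GRing.isLinear.Build k (falg k X) A *:%R
  falg_lift_fun falg_lift_is_linear.
HB.instance Definition _ := GRing.isMonoidMorphism.Build (falg k X) A
  falg_lift_fun falg_lift_is_monoid_morphism.

Definition falg_lift : {lrmorphism falg k X -> A} := falg_lift_fun.

Lemma falg_liftE x : falg_lift (fgen x) = h x.
Proof.
rewrite /falg_lift /= /falg_lift_fun mmapU /= scale1r mul1r.
by rewrite /word_val fmU big_seq1.
Qed.

End Lift.
End FreeAlgebra.

Section Ideal.
Variables (k : fieldType) (A : algType k) (R : A -> Prop).

Inductive in_ideal : A -> Prop :=
| in_ideal_gen x : R x -> in_ideal x
| in_ideal0 : in_ideal 0
| in_idealD x y : in_ideal x -> in_ideal y -> in_ideal (x + y)
| in_idealMl a x : in_ideal x -> in_ideal (a * x)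
| in_idealMr x a : in_ideal x -> in_ideal (x * a).

Fact in_ideal_submod_closed : submod_closed [pred x | `[< in_ideal x >]].
Proof.
split=> [|c x y]; rewrite !inE; first by apply/asboolP/in_ideal0.
move=> /asboolP hx /asboolP hy; apply/asboolP/in_idealD => //.
by rewrite -mulr_algl; apply: in_idealMl.
Qed.

Definition ideal : subspace A := Subspace in_ideal_submod_closed.

Lemma idealP x : reflect (in_ideal x) (x \in ideal).
Proof. by rewrite inE; apply: asboolP. Qed.

Lemma ideal_kill (B : algType k) (f : {lrmorphism A -> B}) :
  (forall x, R x -> f x = 0) -> forall x, x \in ideal -> f x = 0.
Proof.
move=> fR x /idealP; elim=> {x} [x /fR//||x y _ hx _ hy|a x _ hx|x a _ hx].
- exact: rmorph0.
- by rewrite rmorphD /= hx hy addr0.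
- by rewrite rmorphM /= hx mulr0.
- by rewrite rmorphM /= hx mul0r.
Qed.

End Ideal.

HB.mixin Record Lmodule_isPreLie (k : fieldType) L of GRing.Lmodule k L := {
  prelie : L -> L -> L;
  prelie_linearl : forall b, linear (prelie^~ b);
  prelie_linearr : forall a, linear (prelie a);
  prelie_right_sym : forall a1 a2 a3,
    prelie (prelie a1 a2) a3 - prelie a1 (prelie a2 a3)
    = prelie (prelie a1 a3) a2 - prelie a1 (prelie a3 a2)
}.

#[short(type="preLieType")]
HB.structure Definition PreLie (k : fieldType) :=
  {L of GRing.Lmodule k L & Lmodule_isPreLie k L}.

Record preLieHom (k : fieldType) (L L' : preLieType k) := PreLieHom {
  plhom_fun :> {linear L -> L'};
  plhomM : forall a b, plhom_fun (prelie a b) = prelie (plhom_fun a) (plhom_fun b)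
}.

Section LRMorph.
Variables (k : fieldType) (A B : algType k) (f : {lrmorphism A -> B}).

Fact lrmorph_rr x y z x' y' z' : f (x * y - z - (x' * y' - z'))
  = f x * f y - f z - (f x' * f y' - f z').
Proof. by rewrite 3!rmorphB 2!rmorphM. Qed.

Fact lrmorph_rl x y x' y' z s t : f (x * y - x' * y' - (z - s * t))
  = f x * f y - f x' * f y' - (f z - f s * f t).
Proof. by rewrite 3!rmorphB 3!rmorphM. Qed.

End LRMorph.

Section UPreLie.
Variables (k : fieldType) (L : preLieType k).

(* The letters inl a and inr a stand for l_a and r_a.                        *)
Local Notation F := (falg k (L + L)%type).
Local Notation l a := (fgen k (inl a : (L + L)%type)).
Local Notation r a := (fgen k (inr a : (L + L)%type)).

Inductive UPreLie_rel : F -> Prop :=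
| UPreLie_rel_l c a b : UPreLie_rel (l (c *: a + b) - (c *: l a + l b))
| UPreLie_rel_r c a b : UPreLie_rel (r (c *: a + b) - (c *: r a + r b))
| UPreLie_rel_rr a b :
    UPreLie_rel ((r b * r a - r (prelie a b)) - (r a * r b - r (prelie b a)))
| UPreLie_rel_rl a b :
    UPreLie_rel ((r b * l a - l a * r b) - (l (prelie a b) - l a * l b)).

Section Kill.
Variables (A : algType k) (hl hr : L -> A).
Hypothesis hl_linear : linear hl.
Hypothesis hr_linear : linear hr.
Hypothesis h_rr : forall a b,
  hr b * hr a - hr (prelie a b) = hr a * hr b - hr (prelie b a).
Hypothesis h_rl : forall a b,
  hr b * hl a - hl a * hr b = hl (prelie a b) - hl a * hl b.

Definition letter_val (x : (L + L)%type) : A :=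
  match x with inl a => hl a | inr a => hr a end.

Fact U_lift_kill x : x \in ideal UPreLie_rel -> falg_lift letter_val x = 0.
Proof.
move: x; apply: ideal_kill => _ [c a b|c a b|a b|a b].
- by rewrite linearB linearP /= !falg_liftE /= hl_linear subrr.
- by rewrite linearB linearP /= !falg_liftE /= hr_linear subrr.
- by rewrite lrmorph_rr !falg_liftE /= h_rr subrr.
- by rewrite lrmorph_rl !falg_liftE /= h_rl subrr.
Qed.

End Kill.

Definition UPreLie := lquot (ideal UPreLie_rel).
HB.instance Definition _ := GRing.Lmodule.on UPreLie.

End UPreLie.

HB.lock Definition Umul (k : fieldType) (L : preLieType k)
  (x y : UPreLie L) : UPreLie L :=
  lproj (ideal (@UPreLie_rel k L))
    (repr (x : Quotient.quot (subspace_zmod (ideal (@UPreLie_rel k L))))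
     * repr (y : Quotient.quot (subspace_zmod (ideal (@UPreLie_rel k L))))).

Section UPreLieAlgebra.
Variables (k : fieldType) (L : preLieType k).

Local Notation F := (falg k (L + L)%type).
Local Notation l a := (fgen k (inl a : (L + L)%type)).
Local Notation r a := (fgen k (inr a : (L + L)%type)).
Local Notation UPreLie := (UPreLie L).
Local Notation UPreLie_rel := (@UPreLie_rel k L).
Local Notation Umul := (@Umul k L).
Local Notation pr := (lproj (ideal UPreLie_rel) : F -> UPreLie).

Definition Uone : UPreLie := pr 1.
Lemma UmulE u v : Umul (pr u : UPreLie) (pr v) = pr (u * v).
Proof.
rewrite Umul.unlock; set u' := repr _; set v' := repr _.
have /lproj_eq/idealP hu : pr u' = pr u by rewrite /lproj reprK.
have /lproj_eq/idealP hv : pr v' = pr v by rewrite /lproj reprK.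
apply/lproj_eq/idealP.
have -> : u' * v' - u * v = u' * (v' - v) + (u' - u) * v.
  by rewrite mulrBr mulrBl addrA subrK.
by apply: in_idealD; [apply: in_idealMl | apply: in_idealMr].
Qed.

Fact UmulA : associative Umul.
Proof.
move=> x y z; have [[u ->] [v ->]] := (lproj_surj x, lproj_surj y).
by have [w ->] := lproj_surj z; rewrite !UmulE mulrA.
Qed.
Fact Umul1l : left_id Uone Umul.
Proof. by move=> x; have [u ->] := lproj_surj x; rewrite UmulE mul1r. Qed.
Fact Umul1r : right_id Uone Umul.
Proof. by move=> x; have [u ->] := lproj_surj x; rewrite UmulE mulr1. Qed.
Fact UmulDl : left_distributive Umul +%R.
Proof.
move=> x y z; have [[u ->] [v ->]] := (lproj_surj x, lproj_surj y).
by have [w ->] := lproj_surj z; rewrite -linearD !UmulE mulrDl linearD.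
Qed.
Fact UmulDr : right_distributive Umul +%R.
Proof.
move=> x y z; have [[u ->] [v ->]] := (lproj_surj x, lproj_surj y).
by have [w ->] := lproj_surj z; rewrite -linearD !UmulE mulrDr linearD.
Qed.

Fact Uone_neq0 : Uone != 0.
Proof.
apply/eqP; rewrite -(linear0 (lproj (ideal UPreLie_rel))) => /lproj_eq.
rewrite subr0 => /(@U_lift_kill k L k^o (fun=> 0) (fun=> 0)) h.
have /eqP : (1 : k^o) = 0.
  rewrite -(rmorph1 (falg_lift (@letter_val k L k^o (fun=> 0) (fun=> 0)))).
  by apply: h => [c a b|c a b|a b|a b];
     rewrite ?scaler0 ?mulr0 ?addr0 ?subr0.
by rewrite oner_eq0.
Qed.

HB.instance Definition _ := GRing.Zmodule_isNzRing.Build UPreLie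
  UmulA Umul1l Umul1r UmulDl UmulDr Uone_neq0.

Lemma UmulrE (u v : F) : pr u * pr v = pr (u * v).
Proof. exact: UmulE. Qed.

Fact UscaleAl (c : k) (x y : UPreLie) : c *: (x * y) = (c *: x) * y.
Proof.
have [[u ->] [v ->]] := (lproj_surj x, lproj_surj y).
by rewrite UmulrE -[c *: pr (u * v)]linearZ -[c *: pr u]linearZ UmulrE scalerAl.
Qed.

HB.instance Definition _ := GRing.Lmodule_isLalgebra.Build k UPreLie UscaleAl.

Fact UscaleAr (c : k) (x y : UPreLie) : c *: (x * y) = x * (c *: y).
Proof.
have [[u ->] [v ->]] := (lproj_surj x, lproj_surj y).
by rewrite UmulrE -[c *: pr (u * v)]linearZ -[c *: pr v]linearZ UmulrE scalerAr.
Qed.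

HB.instance Definition _ := GRing.Lalgebra_isAlgebra.Build k UPreLie UscaleAr.

Definition Ul (a : L) : UPreLie := pr (l a).
Definition Ur (a : L) : UPreLie := pr (r a).

Lemma Ul_linear : linear Ul.
Proof.
move=> c a b; rewrite /Ul -linearP; apply/lproj_eq/idealP/in_ideal_gen.
exact: UPreLie_rel_l.
Qed.

Lemma Ur_linear : linear Ur.
Proof.
move=> c a b; rewrite /Ur -linearP; apply/lproj_eq/idealP/in_ideal_gen.
exact: UPreLie_rel_r.
Qed.

Lemma Urr a b : Ur b * Ur a - Ur (prelie a b) = Ur a * Ur b - Ur (prelie b a).
Proof.
rewrite /Ur !UmulrE -!linearB; apply/lproj_eq/idealP/in_ideal_gen.
exact: UPreLie_rel_rr.
Qed.

Lemma Url a b : Ur b * Ul a - Ul a * Ur b = Ul (prelie a b) - Ul a * Ul b.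
Proof.
rewrite /Ur /Ul !UmulrE -!linearB; apply/lproj_eq/idealP/in_ideal_gen.
exact: UPreLie_rel_rl.
Qed.

Section Lift.
Variables (A : algType k) (hl hr : L -> A).
Hypothesis hl_linear : linear hl.
Hypothesis hr_linear : linear hr.
Hypothesis h_rr : forall a b,
  hr b * hr a - hr (prelie a b) = hr a * hr b - hr (prelie b a).
Hypothesis h_rl : forall a b,
  hr b * hl a - hl a * hr b = hl (prelie a b) - hl a * hl b.

Definition U_lift_fun : UPreLie -> A := 
  lquot_lift (U_lift_kill hl_linear hr_linear h_rr h_rl).

Fact U_lift_is_linear : linear U_lift_fun.
Proof. by move=> c x y; rewrite /U_lift_fun linearP. Qed.

Fact U_lift_is_monoid_morphism : monoid_morphism U_lift_fun.
Proof.
split=> [|x y]; first by rewrite /U_lift_fun lquot_liftE rmorph1.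
have [[u ->] [v ->]] := (lproj_surj x, lproj_surj y).
by rewrite UmulrE /U_lift_fun !lquot_liftE rmorphM.
Qed.

HB.instance Definition _ := GRing.isLinear.Build k UPreLie A *:%R
  U_lift_fun U_lift_is_linear.
HB.instance Definition _ := GRing.isMonoidMorphism.Build UPreLie A
  U_lift_fun U_lift_is_monoid_morphism.

Definition U_lift : {lrmorphism UPreLie -> A} := U_lift_fun.

Lemma U_lift_l a : U_lift (Ul a) = hl a.
Proof. by rewrite /U_lift /= /U_lift_fun lquot_liftE /= falg_liftE. Qed.

Lemma U_lift_r a : U_lift (Ur a) = hr a.
Proof. by rewrite /U_lift /= /U_lift_fun lquot_liftE /= falg_liftE. Qed.

End Lift.
End UPreLieAlgebra.

Section UPreLieMap.
Variables (k : fieldType) (L L' : preLieType k) (f : preLieHom L L').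

Fact Umap_l_linear : linear (fun a => Ul (f a)).
Proof. by move=> c a b; rewrite linearP Ul_linear. Qed.

Fact Umap_r_linear : linear (fun a => Ur (f a)).
Proof. by move=> c a b; rewrite linearP Ur_linear. Qed.

Fact Umap_rr a b : Ur (f b) * Ur (f a) - Ur (f (prelie a b))
  = Ur (f a) * Ur (f b) - Ur (f (prelie b a)).
Proof. by rewrite !plhomM Urr. Qed.

Fact Umap_rl a b : Ur (f b) * Ul (f a) - Ul (f a) * Ur (f b)
  = Ul (f (prelie a b)) - Ul (f a) * Ul (f b).
Proof. by rewrite !plhomM Url. Qed.

Definition UPreLie_map : {lrmorphism UPreLie L -> UPreLie L'} :=
  U_lift Umap_l_linear Umap_r_linear Umap_rr Umap_rl.

Lemma UPreLie_map_l a : UPreLie_map (Ul a) = Ul (f a).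
Proof. exact: U_lift_l. Qed.

Lemma UPreLie_map_r a : UPreLie_map (Ur a) = Ur (f a).
Proof. exact: U_lift_r. Qed.

End UPreLieMap.

(* Main.v *)
(** Writing [<|] for the pre-Lie product, [T(L) (x) S(L)] is a [U(L)]-module:
    [l_a] multiplies the left factor by [a], and [r_b] acts as
    [D_b (x) 1 + 1 (x) N_b], where [D_b] is the derivation of [T(L)] with
    [D_b a = a <| b - a b] and [N_b s = b s + s <| b], the product [s <| b]
    being extended to [S(L)] by derivations. Right symmetry makes both
    [b |-> D_b] and [b |-> N_b] satisfy the relation of the [r]'s, so that no
    Poincare-Birkhoff-Witt theorem is needed. The isomorphism is
    [u |-> u (1 (x) 1)]. Its inverse sends [a_1 .. a_n (x) s] to
    [l_{a_1} .. l_{a_n} psi(s)], where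
    [psi(1) = 1] and [psi(b s) = r_b psi(s) - psi(s <| b)]; it is visibly
    natural in [L]. *)

Require Import Defs.
From HB Require Import structures.
From mathcomp Require Import all_boot all_order all_algebra all_fingroup.
From mathcomp Require Import finmap boolp.
From mathcomp.multinomials Require Import monalg.

Set Implicit Arguments.
Unset Strict Implicit.
Unset Printing Implicit Defensive.

Import GRing.Theory.
Local Open Scope ring_scope.

(** * Linear maps determined by their values on generators *)

Section Extensionality.
Variable k : fieldType.

Lemma malg_linear_ext (X : choiceType) (W : lmodType k)
    (f g : {linear {malg k[X]} -> W}) :
  (forall x, f << x >> = g << x >>) -> f =1 g.
Proof.
move=> fg u; rewrite (monalgE u) !linear_sum; apply: eq_bigr => x _.
have -> : << u@_x *g x >> = u@_x *: << x >> :> {malg k[X]}.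
  by apply/malgP=> y; rewrite mcoeffZ !mcoeffU mulr_natr.
by rewrite !linearZ_LR fg.
Qed.

Lemma tens_linear_ext (V W E : lmodType k) (f g : {linear tens V W -> E}) :
  (forall v w, f (tpure v w) = g (tpure v w)) -> f =1 g.
Proof.
move=> fg x; have [u ->] := lproj_surj x.
pose p := lproj (lspan (@tens_rel k V W)).
by apply: (malg_linear_ext (f := f \o p) (g := g \o p)) => -[v w]; apply: fg.
Qed.

Lemma tpow_linear_ext (n : nat) (V E : lmodType k)
    (f g : {linear tpow n V -> E}) :
  (forall w, f (pow_pure w) = g (pow_pure w)) -> f =1 g.
Proof.
move=> fg x; have [u ->] := lproj_surj x.
pose p := lproj (lspan (@tpow_rel k n V)).
by apply: (malg_linear_ext (f := f \o p) (g := g \o p)) => w; apply: fg.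
Qed.

Lemma spow_linear_ext (n : nat) (V E : lmodType k)
    (f g : {linear spow n V -> E}) :
  (forall w, f (spow_pure w) = g (spow_pure w)) -> f =1 g.
Proof.
move=> fg x; have [u ->] := lproj_surj x.
pose p := lproj (lspan (@spow_rel k n V)).
by apply: (tpow_linear_ext (f := f \o p) (g := g \o p)) => w; apply: fg.
Qed.

Lemma linear_fun0 (V W : lmodType k) : linear (fun _ : V => 0 : W).
Proof. by move=> c x y; rewrite scaler0 addr0. Qed.

Lemma linear_funD (V W : lmodType k) (f g : V -> W) :
  linear f -> linear g -> linear (fun x => f x + g x).
Proof. by move=> lf lg c x y; rewrite lf lg scalerDr addrACA. Qed.

Lemma linear_funB (V W : lmodType k) (f g : V -> W) :
  linear f -> linear g -> linear (fun x => f x - g x).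
Proof. by move=> lf lg c x y; rewrite lf lg scalerBr opprD addrACA. Qed.

Lemma linear_funZ (V W : lmodType k) (e : k) (f : V -> W) :
  linear f -> linear (fun x => e *: f x).
Proof. by move=> lf c x y; rewrite lf scalerDr !scalerA mulrC. Qed.

Lemma linear_fun_comp (V W E : lmodType k) (g : {linear W -> E}) (f : V -> W) :
  linear f -> linear (fun x => g (f x)).
Proof. by move=> lf c x y; rewrite lf linearP. Qed.

End Extensionality.

(** * The universal property of the direct sum *)

Section DirectSumUniversal.
Variables (k : fieldType) (V : nat -> lmodType k).

(** The components live in different types, so [v] is transported along [n = m]; uniqueness of
    equality proofs on [nat] makes this the identity in degree [n]. *)
Definition dsum_in_fun n (v : V n) m : V m :=
  if n =P m is ReflectT e then ecast j (V j) e v else 0.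

Lemma dsum_in_funn n (v : V n) : dsum_in_fun v n = v.
Proof.
by rewrite /dsum_in_fun; case: eqP => // e; rewrite (eq_irrelevance e (erefl n)).
Qed.

Lemma dsum_in_fun_neq n (v : V n) m : n != m -> dsum_in_fun v m = 0.
Proof. by rewrite /dsum_in_fun; case: eqP. Qed.

Fact dsum_in_fin n (v : V n) :
  exists N, forall m, (N <= m)%N -> dsum_in_fun v m = 0.
Proof. by exists n.+1 => m nm; rewrite dsum_in_fun_neq // ltn_eqF. Qed.

Definition dsum_inj n (v : V n) : dsum V := DSum (dsum_in_fin v).

Fact dsum_inj_is_linear n : linear (@dsum_inj n).
Proof.
move=> c u v; apply: dsumP => m /=.
have [<-|nm] := eqVneq n m; first by rewrite !dsum_in_funn.
by rewrite !dsum_in_fun_neq // scaler0 addr0.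
Qed.

HB.instance Definition _ n := GRing.isLinear.Build k (V n) (dsum V) *:%R
  (@dsum_inj n) (@dsum_inj_is_linear n).

Definition dsum_in n : {linear V n -> dsum V} := @dsum_inj n.

Lemma dsum_val_sum (I : Type) (r : seq I) (F : I -> dsum V) m :
  (\sum_(i <- r) F i : dsum V) m = \sum_(i <- r) F i m.
Proof. by elim: r => [|i r IH]; rewrite ?big_nil // !big_cons -IH. Qed.

Lemma dsum_decomp (x : dsum V) N : (forall n, (N <= n)%N -> x n = 0) ->
  x = \sum_(n < N) dsum_in n (x n).
Proof.
move=> xN; apply: dsumP => m; rewrite dsum_val_sum /=.
have [Nm|mN] := leqP N m.
  rewrite xN // big1 // => i _; apply: dsum_in_fun_neq.
  by rewrite ltn_eqF // (leq_trans (ltn_ord i)).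
rewrite (bigD1 (Ordinal mN)) //= dsum_in_funn big1 ?addr0 // => i ne.
exact: dsum_in_fun_neq.
Qed.

Lemma dsum_linear_ext (E : lmodType k) (f g : {linear dsum V -> E}) :
  (forall n v, f (dsum_in n v) = g (dsum_in n v)) -> f =1 g.
Proof.
move=> fg x; have [N /dsum_decomp ->] := dsum_fin x; rewrite !linear_sum.
by apply: eq_bigr => n _; apply: fg.
Qed.

Section Lift.
Variables (E : lmodType k) (f : forall n, {linear V n -> E}).

Definition dsum_lift_fun (x : dsum V) : E :=
  \sum_(n < projT1 (cid (dsum_fin x))) f n (x n).

(** The bound chosen in [dsum_lift_fun] does not matter, as all terms beyond a valid bound vanish.
    Linearity needs one bound common to several vectors. *)
Lemma dsum_lift_funEw (x : dsum V) N : (forall n, (N <= n)%N -> x n = 0) ->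
  dsum_lift_fun x = \sum_(n < N) f n (x n).
Proof.
rewrite /dsum_lift_fun; case: cid => M /= xM xN.
have sumE P Q : (P <= Q)%N -> (forall n, (P <= n)%N -> x n = 0) ->
    \sum_(n < P) f n (x n) = \sum_(n < Q) f n (x n).
  move=> PQ xP; rewrite (big_ord_widen Q (fun n => f n (x n))) //.
  rewrite big_mkcond; apply: eq_bigr => i _; case: ltnP => // /xP ->.
  by rewrite linear0.
by rewrite (sumE M (maxn M N)) ?leq_maxl // -(sumE N (maxn M N)) ?leq_maxr.
Qed.

Fact dsum_lift_is_linear : linear dsum_lift_fun.
Proof.
move=> c x y; have [[M xM] [N yN]] := (dsum_fin x, dsum_fin y).
have xP n : (maxn M N <= n)%N -> x n = 0 by rewrite geq_max => /andP[/xM].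
have yP n : (maxn M N <= n)%N -> y n = 0 by rewrite geq_max => /andP[_ /yN].
rewrite !(@dsum_lift_funEw _ (maxn M N)) //; last first.
  by move=> n le; rewrite [LHS]/= xP // yP // scaler0 addr0.
rewrite scaler_sumr -big_split; apply: eq_bigr => n _.
by rewrite [X in f n X]/= linearP.
Qed.

HB.instance Definition _ := GRing.isLinear.Build k (dsum V) E *:%R
  dsum_lift_fun dsum_lift_is_linear.

Definition dsum_lift : {linear dsum V -> E} := dsum_lift_fun.

Lemma dsum_liftE n v : dsum_lift (dsum_in n v) = f n v.
Proof.
rewrite /= (@dsum_lift_funEw _ n.+1) => [|m nm]; last first.
  by rewrite /= dsum_in_fun_neq // ltn_eqF.
rewrite big_ord_recr /= dsum_in_funn big1 ?add0r // => i _.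
by rewrite dsum_in_fun_neq ?linear0 // gtn_eqF.
Qed.

End Lift.
End DirectSumUniversal.

Lemma dsum_map_in (k : fieldType) (V W : nat -> lmodType k)
    (f : forall n, {linear V n -> W n}) n v :
  dsum_map f (dsum_in V n v) = dsum_in W n (f n v).
Proof.
apply: dsumP => m /=; have [<-|nm] := eqVneq n m; first by rewrite !dsum_in_funn.
by rewrite !dsum_in_fun_neq // linear0.
Qed.

(** * Tensors and symmetric tensors through words of arbitrary length *)

Section Words.
Variables (k : fieldType) (V : lmodType k).

(** One function on words of all lengths encodes a multilinear map in each degree, so that recursion
    on words meets no type indexed by the length. *)
Definition multilinear (E : lmodType k) (h : seq V -> E) :=
  forall s1 s2, linear (fun a => h (s1 ++ a :: s2)).

Definition swap_invariant (E : Type) (h : seq V -> E) :=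
  forall s1 a b s2, h (s1 ++ a :: b :: s2) = h (s1 ++ b :: a :: s2).

(** Adjacent transpositions generate all permutations: the head of [s] is located in [t] and brought
    to the front, and induction treats the rest. *)
Lemma swap_invariant_perm (E : Type) (h : seq V -> E) s t :
  swap_invariant h -> perm_eq s t -> h s = h t.
Proof.
elim: s h t => [|a s IH] h t hS st.
  by move: st; rewrite perm_sym => /perm_nilP ->.
have /splitPr at_ : a \in t by rewrite -(perm_mem st) mem_head.
case: at_ st => t1 t2 st.
have {}st : perm_eq s (t1 ++ t2).
  by move: st; rewrite perm_sym perm_catC /= perm_cons perm_catC perm_sym.
(* [a] moves left past the letters of [t1], the last one first. *)
have -> : h (t1 ++ a :: t2) = h (a :: t1 ++ t2).
  elim/last_ind: t1 {st} t2 => [//|t1 b IHt] t2.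
  by rewrite !cat_rcons hS IHt.
by apply: (IH (fun w => h (a :: w))) => // s1 x y s2; apply: (hS (a :: s1)).
Qed.

Definition word_of n (w : {ffun 'I_n -> V}) : seq V := codom w.

Definition ffun_of n (s : seq V) : {ffun 'I_n -> V} := [ffun i : 'I_n => nth 0 s i].

Lemma size_word_of n (w : {ffun 'I_n -> V}) : size (word_of w) = n.
Proof. by rewrite size_codom card_ord. Qed.

Lemma nth_word_of n (w : {ffun 'I_n -> V}) (i : 'I_n) :
  nth 0 (word_of w) i = w i.
Proof. by rewrite /word_of codomE (nth_map i) ?size_enum_ord // nth_ord_enum. Qed.

Lemma word_ofK n (w : {ffun 'I_n -> V}) : ffun_of n (word_of w) = w.
Proof. by apply/ffunP=> i; rewrite ffunE nth_word_of. Qed.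

Lemma ffun_ofK s : word_of (ffun_of (size s) s) = s.
Proof.
apply: (@eq_from_nth _ 0) => [|i]; rewrite size_word_of // => lt.
by rewrite -[i]/(val (Ordinal lt)) nth_word_of ffunE.
Qed.

Lemma word_of_subst n (w : {ffun 'I_n -> V}) i a :
  word_of (subst_at w i a) = take i (word_of w) ++ a :: drop i.+1 (word_of w).
Proof.
have -> : take i (word_of w) ++ a :: drop i.+1 (word_of w)
    = set_nth 0 (word_of w) i a by rewrite set_nthE size_word_of ltn_ord.
apply: (@eq_from_nth _ 0) => [|j].
  by rewrite size_set_nth !size_word_of (maxn_idPr _).
rewrite size_word_of => lt; rewrite nth_set_nth -[j]/(val (Ordinal lt)).
by rewrite nth_word_of ffunE /= -[j in RHS]/(val (Ordinal lt)) nth_word_of.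
Qed.

(** The [0] is a placeholder that gets overwritten; it exposes one letter of a word as an argument
    of [subst_at]. *)
Lemma ffun_of_subst n s1 s2 (lt : (size s1 < n)%N) a :
  ffun_of n (s1 ++ a :: s2)
  = subst_at (ffun_of n (s1 ++ 0 :: s2)) (Ordinal lt) a.
Proof.
apply/ffunP=> j; rewrite !ffunE !nth_cat -val_eqE /=.
have [//|gt|->] := ltngtP (nat_of_ord j) (size s1); last by rewrite subnn.
by rewrite -(subnSK gt).
Qed.

Lemma perm_word_of n (w : {ffun 'I_n -> V}) (s : 'S_n) :
  perm_eq (word_of [ffun j => w (s j)]) (word_of w).
Proof.
rewrite /word_of !codomE.
have -> : [seq [ffun j => w (s j)] j | j <- enum 'I_n]
    = [seq w j | j <- [seq s j | j <- enum 'I_n]].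
  by rewrite -[RHS]map_comp; apply: eq_map => j; rewrite ffunE.
apply: perm_map; apply: uniq_perm; rewrite ?enum_uniq //.
  by rewrite map_inj_uniq ?enum_uniq //; apply: perm_inj.
move=> j; rewrite mem_enum; apply/mapP; exists (s^-1%g j).
  by rewrite mem_enum.
by rewrite permKV.
Qed.

Lemma multilinear_word_of (E : lmodType k) (h : seq V -> E) n
    (w : {ffun 'I_n -> V}) i :
  multilinear h -> linear (fun a => h (word_of (subst_at w i a))).
Proof. by move=> hM c a b; rewrite !word_of_subst hM. Qed.

Definition tw (s : seq V) : Tmod V :=
  dsum_in (fun n => tpow n V) (size s) (pow_pure (ffun_of (size s) s)).

(** Frees the degree from [size s]: words to be compared may have lengths that are equal without
    being convertible. *)
Lemma twE n s : size s = n ->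
  tw s = dsum_in (fun n => tpow n V) n (pow_pure (ffun_of n s)).
Proof. by move=> <-. Qed.

Lemma tw_multilinear : multilinear tw.
Proof.
move=> s1 s2 c a b; set n := (size s1 + (size s2).+1)%N.
have lt : (size s1 < n)%N by rewrite /n addnS ltnS leq_addr.
have twn x := @twE n (s1 ++ x :: s2) (size_cat s1 (x :: s2)).
rewrite 3!twn (ffun_of_subst _ lt (_ + _)) pow_pureP -2!ffun_of_subst.
by rewrite linearP.
Qed.

Lemma Tmod_linear_ext (E : lmodType k) (f g : {linear Tmod V -> E}) :
  (forall s, f (tw s) = g (tw s)) -> f =1 g.
Proof.
move=> fg; apply: dsum_linear_ext => n v.
pose i := dsum_in (fun n => tpow n V) n.
apply: (tpow_linear_ext (f := f \o i) (g := g \o i)) => w.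
by have := fg (word_of w); rewrite (@twE n) ?size_word_of // word_ofK.
Qed.

Section TLift.
Variables (E : lmodType k) (h : seq V -> E) (hM : multilinear h).

Definition Tlift : {linear Tmod V -> E} :=
  dsum_lift (fun n => tpow_lift (h := fun w => h (word_of w))
    (fun w i => @multilinear_word_of E h n w i hM)).

Lemma TliftE s : Tlift (tw s) = h s.
Proof. by rewrite /Tlift dsum_liftE tpow_liftE ffun_ofK. Qed.

End TLift.

Definition sw (s : seq V) : Smod V :=
  dsum_in (fun n => spow n V) (size s) (spow_pure (ffun_of (size s) s)).

Lemma swE n s : size s = n ->
  sw s = dsum_in (fun n => spow n V) n (spow_pure (ffun_of n s)).
Proof. by move=> <-. Qed.

Lemma sw_multilinear : multilinear sw.
Proof.
move=> s1 s2 c a b; set n := (size s1 + (size s2).+1)%N.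
have lt : (size s1 < n)%N by rewrite /n addnS ltnS leq_addr.
have swn x := @swE n (s1 ++ x :: s2) (size_cat s1 (x :: s2)).
rewrite 3!swn (ffun_of_subst _ lt (_ + _)) /spow_pure pow_pureP -2!ffun_of_subst.
by rewrite 2!linearP.
Qed.

Lemma sw_swap_invariant : swap_invariant sw.
Proof.
move=> s1 a b s2; set n := (size s1 + (size s2).+2)%N.
rewrite [LHS](@swE n) ?size_cat // [RHS](@swE n) ?size_cat //.
congr (dsum_in _ _ _).
have lt1 : (size s1 < n)%N by rewrite /n addnS ltnS leq_addr.
have lt2 : ((size s1).+1 < n)%N by rewrite /n !addnS !ltnS leq_addr.
pose i := Ordinal lt1; pose j := Ordinal lt2.
(* The exchange is the transposition of the positions [size s1] and [(size s1).+1], so one generator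
   of [spow_rel] identifies the two words. *)
have -> : ffun_of n (s1 ++ a :: b :: s2)
    = [ffun x => ffun_of n (s1 ++ b :: a :: s2) (tperm i j x)].
  apply/ffunP=> x; rewrite !ffunE; case: tpermP => [->|->|/eqP xi /eqP xj] /=.
  - by rewrite !nth_cat ltnn subnn ltnNge leqnSn subSnn.
  - by rewrite !nth_cat ltnn subnn ltnNge leqnSn subSnn.
  rewrite !nth_cat; case: ltnP => // le.
  (* Past [s1], the offsets 0 and 1 are the excluded positions [i] and [j]; from offset 2 on both
     words read [s2]. *)
  case E : (x - size s1)%N => [|[|m]] //=.
    by case/eqP: xi; apply: val_inj; apply/eqP; rewrite /= eqn_leq le -subn_eq0 E.
  by case/eqP: xj; apply: val_inj; rewrite /= -(subnK le) E.
by apply/lproj_eq/lspan_gen/spow_relP.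
Qed.

Lemma Smod_linear_ext (E : lmodType k) (f g : {linear Smod V -> E}) :
  (forall s, f (sw s) = g (sw s)) -> f =1 g.
Proof.
move=> fg; apply: dsum_linear_ext => n v.
pose i := dsum_in (fun n => spow n V) n.
apply: (spow_linear_ext (f := f \o i) (g := g \o i)) => w.
by have := fg (word_of w); rewrite (@swE n) ?size_word_of // word_ofK.
Qed.

Section SLift.
Variables (E : lmodType k) (h : seq V -> E).
Hypotheses (hM : multilinear h) (hS : swap_invariant h).

Definition Slift : {linear Smod V -> E} :=
  dsum_lift (fun n => spow_lift (h := fun w => h (word_of w))
    (fun w i => @multilinear_word_of E h n w i hM)
    (fun w s => swap_invariant_perm hS (perm_word_of w s))).

Lemma SliftE s : Slift (sw s) = h s.
Proof. by rewrite /Slift dsum_liftE spow_liftE ffun_ofK. Qed.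

End SLift.
End Words.

(** * Functoriality on words *)

Section WordMaps.
Variables (k : fieldType) (V V' : lmodType k) (f : {linear V -> V'}).

Lemma map_word_ffun_of s :
  map_word f (ffun_of (size s) s) = ffun_of (size s) (map f s).
Proof. by apply/ffunP=> i; rewrite !ffunE (nth_map 0). Qed.

Lemma Tmod_map_tw s : Tmod_map f (tw s) = tw (map f s).
Proof.
rewrite /Tmod_map dsum_map_in tpow_mapE map_word_ffun_of.
by rewrite [RHS](@twE _ _ (size s)) ?size_map.
Qed.

Lemma Smod_map_sw s : Smod_map f (sw s) = sw (map f s).
Proof.
rewrite /Smod_map dsum_map_in spow_mapE map_word_ffun_of.
by rewrite [RHS](@swE _ _ (size s)) ?size_map.
Qed.

End WordMaps.

Arguments Tlift {k V E h} hM.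
Arguments Slift {k V E h} hM hS.

(* Proves that two sums in a [zmodType] have the same summands up to order.  *)
Ltac sum_ac :=
  rewrite -[LHS]addr0 -[RHS]addr0 -?addrA;
  repeat lazymatch goal with
  | |- @eq _ (?x + _) _ =>
    first [ refine (f_equal (+%R x) _)
          | rewrite [RHS](addrCA _ x) | rewrite [in RHS](addrCA _ x) ]
  end; reflexivity.

Lemma eq_sub_add (Z : zmodType) (a b c d : Z) :
  a - b = c - d -> a + d = c + b.
Proof.
move=> /(congr1 (fun z => z + b + d)).
by rewrite subrK (addrAC (c - d)) subrK.
Qed.

Lemma eq_add_sub (Z : zmodType) (a b c d : Z) :
  a + d = c + b -> a - b = c - d.
Proof.
move=> /(congr1 (fun z => z - b - d)).
by rewrite addrK (addrAC a) addrK.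
Qed.

(** * Derivations of the tensor algebra and their commutation relation *)

Section InsertionDerivation.
Variables (k : fieldType) (L : preLieType k) (e : k).

(* [insder e h b w] is the value of the multilinear map [h] on the image of  *)
(* the word [w] under the derivation [x |-> x <| b - e (x b)] of the tensor  *)
(* algebra.                                                                  *)
Fixpoint insder (E : lmodType k) (h : seq L -> E) (b : L) (w : seq L) : E :=
  if w is x :: v
  then h (prelie x b :: v) - e *: h (x :: b :: v) + insder (fun u => h (x :: u)) b v
  else 0.

Lemma eq_insder (E : lmodType k) (h h' : seq L -> E) b w :
  h =1 h' -> insder h b w = insder h' b w.
Proof.
elim: w h h' => //= x w IH h h' hh'; rewrite !hh'; congr (_ + _).
by apply: IH => v; apply: hh'.
Qed.

Lemma insderP (E : lmodType k) c (h h' : seq L -> E) b w :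
  insder (fun v => c *: h v + h' v) b w = c *: insder h b w + insder h' b w.
Proof.
elim: w h h' => /= [|x w IH] h h'; first by rewrite scaler0 addr0.
rewrite IH !scalerDr scalerN !scalerA (mulrC e) opprD; sum_ac.
Qed.

Lemma insder_linear_comp (E F : lmodType k) (f : {linear E -> F}) h b w :
  f (insder h b w) = insder (fun v => f (h v)) b w.
Proof.
elim: w h => /= [|x w IH] h; first exact: linear0.
by rewrite linearD linearB linearZ_LR IH.
Qed.

Lemma insderD (E : lmodType k) (h h' : seq L -> E) b w :
  insder (fun v => h v + h' v) b w = insder h b w + insder h' b w.
Proof.
rewrite -[insder h b w]scale1r -insderP.
by apply: eq_insder => v; rewrite scale1r.
Qed.

Lemma insderB (E : lmodType k) (h h' : seq L -> E) b w :
  insder (fun v => h v - h' v) b w = insder h b w - insder h' b w.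
Proof.
rewrite -[in RHS]scaleN1r addrC -insderP.
by apply: eq_insder => v; rewrite scaleN1r addrC.
Qed.

Lemma insderZ (E : lmodType k) c (h : seq L -> E) b w :
  insder (fun v => c *: h v) b w = c *: insder h b w.
Proof. by rewrite (insder_linear_comp ( *:%R c)). Qed.

Lemma insder0 (E : lmodType k) b w : insder (fun=> 0 : E) b w = 0.
Proof. by elim: w => //= x w ->; rewrite scaler0 subr0 addr0. Qed.

Lemma multilinear_cons (E : lmodType k) (h : seq L -> E) x :
  multilinear h -> multilinear (fun v => h (x :: v)).
Proof. by move=> hM s1 s2; apply: (hM (x :: s1)). Qed.

Lemma multilinear_head (E : lmodType k) (h : seq L -> E) w :
  multilinear h -> linear (fun a => h (a :: w)).
Proof. by move=> hM; apply: (hM [::]). Qed.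

Lemma insder_linear (E : lmodType k) (h : seq L -> E) w :
  multilinear h -> linear (fun b => insder h b w).
Proof.
elim: w h => /= [|x w IH] h hM; first exact: linear_fun0.
apply: linear_funD; last by apply: IH; apply: multilinear_cons.
apply: linear_funB.
  by move=> c a b; rewrite prelie_linearr (multilinear_head _ hM).
by apply: linear_funZ; apply: (hM [:: x]).
Qed.

Lemma insder_multilinear (E : lmodType k) (h : seq L -> E) b :
  multilinear h -> multilinear (insder h b).
Proof.
move=> hM s1; elim: s1 h hM => [|x s1 IH] h hM s2 /=.
  apply: linear_funD; first apply: linear_funB.
  - by move=> c a a'; rewrite prelie_linearl (multilinear_head _ hM).
  - by apply: linear_funZ; apply: (hM [::]).
  move=> c a a'; rewrite -insderP; apply: eq_insder => v.
  exact: (hM [::]).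
apply: linear_funD; last by apply: IH; apply: multilinear_cons.
apply: linear_funB; first exact: (hM (_ :: s1)).
by apply: linear_funZ; apply: (hM [:: x, b & s1]).
Qed.

(** With [D_b] for the derivation, this is [D_c D_b - D_{b <| c} = D_b D_c - D_{c <| b}], the
    relation of the [r]'s. Induction reduces it to one letter, where it is the right symmetry of
    [<|]; in the form with sums, the terms carrying [e] are symmetric in [b] and [c]. *)
Lemma insder_comm (E : lmodType k) (h : seq L -> E) b c w : multilinear h ->
  insder (insder h c) b w + insder h (prelie c b) w
  = insder (insder h b) c w + insder h (prelie b c) w.
Proof.
elim: w h => [//|x w IH] h hM.
have {}IH := IH _ (multilinear_cons x hM).
(* Only the first two groups are not plainly symmetric in [b'] and [c']: right symmetry settles the
   first, induction the second. *)
have step b' c' : insder (insder h c') b' (x :: w) + insder h (prelie c' b') (x :: w)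
  = (h (prelie (prelie x b') c' :: w) + h (prelie x (prelie c' b') :: w))
    + (insder (insder (fun u => h (x :: u)) c') b' w
       + insder (fun u => h (x :: u)) (prelie c' b') w)
    + ((insder (fun u => h (prelie x b' :: u)) c' w
        + insder (fun u => h (prelie x c' :: u)) b' w)
    - (e *: h [:: prelie x b', c' & w] + e *: h [:: prelie x c', b' & w])
    - (e *: h [:: x, prelie c' b' & w] + e *: h [:: x, prelie b' c' & w])
    + (e *: (e *: h [:: x, c', b' & w]) + e *: (e *: h [:: x, b', c' & w]))
    - (e *: insder (fun u => h [:: x, b' & u]) c' w
       + e *: insder (fun u => h [:: x, c' & u]) b' w)).
  rewrite /= insderD insderB insderZ !(scalerDr, scalerBr, scalerN, opprD, opprK).
  sum_ac.
have hD a a' : h (a :: w) + h (a' :: w) = h (a + a' :: w).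
  by rewrite -[a]scale1r (multilinear_head _ hM) !scale1r.
have symx : prelie (prelie x b) c + prelie x (prelie c b)
    = prelie (prelie x c) b + prelie x (prelie b c).
  exact/eq_sub_add/prelie_right_sym.
rewrite !step IH !hD symx !opprD; sum_ac.
Qed.

End InsertionDerivation.

(** For [e = 0] the derivation preserves length, so only words as long as [w] are evaluated. *)
Lemma eq_insder0_size (k : fieldType) (L : preLieType k) (E : lmodType k)
    (h h' : seq L -> E) b w :
  (forall v, size v = size w -> h v = h' v) -> insder 0 h b w = insder 0 h' b w.
Proof.
elim: w h h' => //= x w IH h h' hh'; rewrite !scale0r hh' //.
by congr (_ + _); apply: IH => v vw; apply: hh'; rewrite /= vw.
Qed.

(** For [e = 0] each term replaces one letter in place, so exchanging two letters of the word only
    permutes the terms. *)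
Lemma insder0_swap_invariant (k : fieldType) (L : preLieType k)
    (E : lmodType k) (h : seq L -> E) b :
  swap_invariant h -> swap_invariant (insder 0 h b).
Proof.
move=> hS s1; elim: s1 h hS => [|z s1 IH] h hS x y s2 /=.
  rewrite !scale0r !subr0.
  rewrite (hS [::] (prelie x b)) (hS [::] x) /=.
  rewrite (eq_insder _ _ _ (fun u => hS [::] x y u)) /=; sum_ac.
rewrite !scale0r !subr0 (hS (_ :: s1)); congr (_ + _).
by apply: IH => s1' x' y' s2'; apply: (hS (z :: s1')).
Qed.

(** * The map from [T(L) (x) S(L)] to [U(L)] *)

Section InverseOnSymmetricPart.
Variables (k : fieldType) (L : preLieType k).
Local Notation U := (UPreLie L).

(* Inverts the action [r_b s = b s + s <| b] of the [r]'s on [S(L)]. The     *)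
(* recursion is on a bound [n] for the length, since [w <| b] is not a       *)
(* subword of [b :: w]; longer words get the junk value [0], which keeps     *)
(* [psi n] multilinear and symmetric.                                        *)
Fixpoint psi (n : nat) : seq L -> U :=
  if n is m.+1
  then fun w => if w is b :: v then Ur b * psi m v - insder 0 (psi m) b v else 1
  else fun w => if w is [::] then 1 else 0.

Definition Umull (u v : U) : U := u * v.

Fact Umull_is_linear u : linear (Umull u).
Proof. by move=> c x y; rewrite /Umull mulrDr scalerAr. Qed.

HB.instance Definition _ u := GRing.isLinear.Build k U U *:%R
  (Umull u) (Umull_is_linear u).

Lemma linear_mull (u : U) (E : lmodType k) (f : E -> U) :
  linear f -> linear (fun x => u * f x).
Proof. exact: (@linear_fun_comp k E U U (Umull u)). Qed.

Definition Umulr (u v : U) : U := v * u.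

Fact Umulr_is_linear u : linear (Umulr u).
Proof. by move=> c x y; rewrite /Umulr mulrDl scalerAl. Qed.

HB.instance Definition _ u := GRing.isLinear.Build k U U *:%R
  (Umulr u) (Umulr_is_linear u).

Lemma linear_mulr (u : U) (E : lmodType k) (f : E -> U) :
  linear f -> linear (fun x => f x * u).
Proof. exact: (@linear_fun_comp k E U U (Umulr u)). Qed.

Lemma psi_multilinear n : multilinear (psi n).
Proof.
elim: n => [|n IH] [|b s1] s2 /=; try exact: linear_fun0.
  apply: linear_funB; first by apply: linear_mulr; apply: Ur_linear.
  exact: insder_linear.
apply: linear_funB; first exact: linear_mull.
exact: insder_multilinear.
Qed.

Lemma insder_mull e (u : U) (h : seq L -> U) b w :
  insder e (fun v => u * h v) b w = u * insder e h b w.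
Proof. exact/esym/(insder_linear_comp e (Umull u)). Qed.

(** Away from the front, the recursion preserves symmetry. At the front, expanding twice yields
    [r_a r_b - r_{b <| a}] and a sum of derivations, invariant under exchange of [a] and [b] by
    [Urr] and [insder_comm]; the mixed terms are visibly symmetric. *)
Lemma psi_swap_invariant n : swap_invariant (psi n).
Proof.
elim: n => [|n IH] [|x s1] a b s2 //; last first.
  by rewrite /= IH (insder0_swap_invariant _ IH).
(* The bound 1 is too small for two letters: both sides are the junk value 0. *)
case: n IH => [|n] IH; first by rewrite /= !insder0 !scale0r !mulr0.
have step a' b' : psi n.+2 [:: a', b' & s2]
  = Ur a' * Ur b' * psi n s2 - Ur (prelie b' a') * psi n s2
    + (insder 0 (insder 0 (psi n) b') a' s2 + insder 0 (psi n) (prelie b' a') s2)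
    - (Ur a' * insder 0 (psi n) b' s2 + Ur b' * insder 0 (psi n) a' s2).
  rewrite /= insderB insder_mull scale0r subr0 mulrBr mulrA !(opprD, opprB, opprK).
  sum_ac.
rewrite !step (insder_comm _ _ _ _ (@psi_multilinear n)) -!mulrBl.
rewrite (Urr b a) !opprD; sum_ac.
Qed.

(** The recursion [psi(b s) = r_b psi(s) - psi(s <| b)] without the bound, since the words of
    [w <| b] have the length of [w]. *)
Lemma psi_cons b w : psi (size w).+1 (b :: w)
  = Ur b * psi (size w) w - insder 0 (fun v => psi (size v) v) b w.
Proof.
by rewrite /=; congr (_ - _); apply: eq_insder0_size => v ->.
Qed.

Lemma psi_size_multilinear : multilinear (fun w => psi (size w) w).
Proof. by move=> s1 s2 c x y; rewrite !size_cat /=; apply: psi_multilinear. Qed.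

Lemma psi_size_swap_invariant : swap_invariant (fun w => psi (size w) w).
Proof. by move=> s1 x y s2; rewrite !size_cat /=; apply: psi_swap_invariant. Qed.

Definition psiS : {linear Smod L -> U} :=
  Slift psi_size_multilinear psi_size_swap_invariant.

Lemma psiSE w : psiS (sw w) = psi (size w) w.
Proof. exact: SliftE. Qed.

Definition lprod (w : seq L) : U := \prod_(a <- w) Ul a.

Lemma lprod_multilinear : multilinear lprod.
Proof.
move=> s1 s2 c x y; rewrite /lprod !big_cat !big_cons /= Ul_linear.
by rewrite mulrDl mulrDr scalerAr scalerAl.
Qed.

Definition psiT : {linear Tmod L -> U} := Tlift lprod_multilinear.

Lemma psiTE w : psiT (tw w) = lprod w.
Proof. exact: TliftE. Qed.

Definition psi_pure (t : Tmod L) (s : Smod L) : U := psiT t * psiS s.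

Fact psi_pure_linearl s : linear (psi_pure^~ s).
Proof. by apply: linear_mulr; apply: linearP. Qed.

Fact psi_pure_linearr t : linear (psi_pure t).
Proof. by apply: linear_mull; apply: linearP. Qed.

Definition Psi : {linear tens (Tmod L) (Smod L) -> U} :=
  tens_lift psi_pure_linearl psi_pure_linearr.

Lemma PsiE t s : Psi (tpure t s) = psiT t * psiS s.
Proof. exact: tens_liftE. Qed.

End InverseOnSymmetricPart.

(** The linearity proofs inside a bundled map are propositions, hence equal; identities of
    endomorphisms can thus be checked pointwise. *)
Lemma linear_map_eq (k : fieldType) (V W : lmodType k)
  (f g : {linear V -> W}) : f =1 g -> f = g.
Proof.
move=> /funext; case: f g => [f cf] [g cg] /= fg; subst g; congr GRing.Linear.Pack.
move: cf cg => [[c1] [c2]] [[d1] [d2]].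
by rewrite (Prop_irrelevance c1 d1) (Prop_irrelevance c2 d2).
Qed.

(** * The endomorphism algebra of a nonzero vector space *)

Section EndomorphismAlgebra.
Variables (k : fieldType) (V : lmodType k) (v0 : V) (v0_neq0 : v0 != 0).

(* An [algType] must be nontrivial, hence the nonzero vector.                *)
Definition endo of v0 != 0 := {linear V -> V}.
Local Notation endoV := (endo v0_neq0).

HB.instance Definition _ := gen_eqMixin endoV.
HB.instance Definition _ := gen_choiceMixin endoV.

Definition endo0 : endoV := (\0 : V -> V) : {linear V -> V}.
Definition endo1 : endoV := (idfun : V -> V) : {linear V -> V}.
Definition endoD (f g : endoV) : endoV :=
  ((f : {linear V -> V}) \+ (g : {linear V -> V})) : {linear V -> V}.
Definition endoZ c (f : endoV) : endoV :=
  (c \*: (f : {linear V -> V})) : {linear V -> V}.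
Definition endoM (f g : endoV) : endoV :=
  ((f : {linear V -> V}) \o (g : {linear V -> V})) : {linear V -> V}.

Fact endoDA : associative endoD.
Proof. by move=> f g h; apply: linear_map_eq => v /=; rewrite addrA. Qed.
Fact endoDC : commutative endoD.
Proof. by move=> f g; apply: linear_map_eq => v /=; rewrite addrC. Qed.
Fact endo0D : left_id endo0 endoD.
Proof. by move=> f; apply: linear_map_eq => v /=; rewrite add0r. Qed.
Fact endoND : left_inverse endo0 (endoZ (-1)) endoD.
Proof. by move=> f; apply: linear_map_eq => v /=; rewrite scaleN1r addNr. Qed.

HB.instance Definition _ :=
  GRing.isZmodule.Build endoV endoDA endoDC endo0D endoND.

Fact endoMA : associative endoM.
Proof. by move=> f g h; apply: linear_map_eq. Qed.
Fact endo1M : left_id endo1 endoM.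
Proof. by move=> f; apply: linear_map_eq. Qed.
Fact endoM1 : right_id endo1 endoM.
Proof. by move=> f; apply: linear_map_eq. Qed.
Fact endoMDl : left_distributive endoM +%R.
Proof. by move=> f g h; apply: linear_map_eq. Qed.
Fact endoMDr : right_distributive endoM +%R.
Proof. by move=> f g h; apply: linear_map_eq => v /=; rewrite linearD. Qed.
Fact endo1_neq0 : endo1 != 0.
Proof.
apply/eqP=> /(congr1 (fun f : endoV => (f : {linear V -> V}) v0)) /= v00.
by case/eqP: v0_neq0.
Qed.

HB.instance Definition _ := GRing.Zmodule_isNzRing.Build endoV
  endoMA endo1M endoM1 endoMDl endoMDr endo1_neq0.

Fact endoZA a b (f : endoV) : endoZ a (endoZ b f) = endoZ (a * b) f.
Proof. by apply: linear_map_eq => v /=; rewrite scalerA. Qed.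
Fact endoZ1 : left_id 1 endoZ.
Proof. by move=> f; apply: linear_map_eq => v /=; rewrite scale1r. Qed.
Fact endoZDr : right_distributive endoZ +%R.
Proof. by move=> c f g; apply: linear_map_eq => v /=; rewrite scalerDr. Qed.
Fact endoZDl (f : endoV) : {morph endoZ^~ f : a b / a + b}.
Proof. by move=> a b; apply: linear_map_eq => v /=; rewrite scalerDl. Qed.

HB.instance Definition _ := GRing.Zmodule_isLmodule.Build k endoV
  endoZA endoZ1 endoZDr endoZDl.

Fact endoZAl (c : k) (f g : endoV) : c *: (f * g) = c *: f * g.
Proof. exact: linear_map_eq. Qed.

HB.instance Definition _ := GRing.Lmodule_isLalgebra.Build k endoV endoZAl.

Fact endoZAr (c : k) (f g : endoV) : c *: (f * g) = f * (c *: g).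
Proof. by apply: linear_map_eq => v /=; rewrite linearZ_LR. Qed.

HB.instance Definition _ := GRing.Lalgebra_isAlgebra.Build k endoV endoZAr.

End EndomorphismAlgebra.

(** * Induction over [U(L)] *)

Section UPreLieLinearExt.
Variables (k : fieldType) (L : preLieType k) (W : lmodType k).

(** [U(L)] is spanned by the words in the [l]'s and [r]'s, and agreement propagates one leading
    letter at a time. *)
Lemma UPreLie_linear_ext (f g : {linear UPreLie L -> W}) : f 1 = g 1 ->
  (forall a u, f u = g u -> f (Ul a * u) = g (Ul a * u)) ->
  (forall a u, f u = g u -> f (Ur a * u) = g (Ur a * u)) -> f =1 g.
Proof.
move=> fg1 fgl fgr x; have [u ->] := lproj_surj x.
pose p := lproj (ideal (@UPreLie_rel k L)).
apply: (malg_linear_ext (f := f \o p) (g := g \o p)) => -[s] /=.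
have fg_cast (v w : UPreLie L) : v = w -> f w = g w -> f v = g v by move=> ->.
elim: s => [|y s IH].
  apply: (fg_cast _ 1 _ fg1).
  by congr p; congr (<< _ >>); apply/esym/fmoneE.
(* The word [y :: s] is the product of [y] and [s] in the free algebra, hence also in its
   quotient. *)
apply: (fg_cast _ ((p (fgen k y) : UPreLie L) * (p << FMonom s >> : UPreLie L))).
  rewrite UmulrE; congr p.
  rewrite -[RHS]/(falg_mul _ _) falg_mul.unlock /fgen malgM_def fgmulUU mulr1.
  by congr (<< _ >>); rewrite fmuE; apply/esym/fmmulE.
by case: y => a; [apply: fgl | apply: fgr].
Qed.

End UPreLieLinearExt.

(** * Modules over [U(L)] from operators satisfying its relations *)

Section UAction.
Variables (k : fieldType) (L : preLieType k) (V : lmodType k).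
Variables (v0 : V) (v0_neq0 : v0 != 0).
Variables (lact ract : L -> {linear V -> V}).
Hypothesis lact_linear : forall v, linear (lact^~ v).
Hypothesis ract_linear : forall v, linear (ract^~ v).
Hypothesis ract_ract : forall a b v,
  ract b (ract a v) - ract (prelie a b) v = ract a (ract b v) - ract (prelie b a) v.
Hypothesis ract_lact : forall a b v,
  ract b (lact a v) - lact a (ract b v) = lact (prelie a b) v - lact a (lact b v).

Local Notation A := (endo v0_neq0).

Fact lact_endo_linear : linear (lact : L -> A).
Proof. by move=> c a b; apply: linear_map_eq => v; apply: lact_linear. Qed.

Fact ract_endo_linear : linear (ract : L -> A).
Proof. by move=> c a b; apply: linear_map_eq => v; apply: ract_linear. Qed.

Fact endo_subE (f g : A) v :
  (f - g : A) v = (f : {linear V -> V}) v - (g : {linear V -> V}) v.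
Proof. by rewrite -[RHS]/(_ + - _) -scaleN1r. Qed.

Fact ract_endo_ract a b : (ract b : A) * (ract a : A) - (ract (prelie a b) : A)
  = (ract a : A) * (ract b : A) - (ract (prelie b a) : A).
Proof. by apply: linear_map_eq => v; rewrite !endo_subE; apply: ract_ract. Qed.

Fact ract_endo_lact a b : (ract b : A) * (lact a : A) - (lact a : A) * (ract b : A)
  = (lact (prelie a b) : A) - (lact a : A) * (lact b : A).
Proof. by apply: linear_map_eq => v; rewrite !endo_subE; apply: ract_lact. Qed.

(** Multiplication in [A] is composition, so the hypotheses on [lact] and [ract] are the relations
    that the universal property of [U(L)] asks for. *)
Definition Urep : {lrmorphism UPreLie L -> A} :=
  U_lift lact_endo_linear ract_endo_linear ract_endo_ract ract_endo_lact.

Definition Uorbit_fun (u : UPreLie L) : V := (Urep u : {linear V -> V}) v0.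

Fact Uorbit_is_linear : linear Uorbit_fun.
Proof. by move=> c x y; rewrite /Uorbit_fun linearP. Qed.

HB.instance Definition _ := GRing.isLinear.Build k (UPreLie L) V *:%R
  Uorbit_fun Uorbit_is_linear.

Definition Uorbit : {linear UPreLie L -> V} := Uorbit_fun.

Lemma Uorbit1 : Uorbit 1 = v0.
Proof. by rewrite /Uorbit /= /Uorbit_fun rmorph1. Qed.

Lemma Uorbit_l a u : Uorbit (Ul a * u) = lact a (Uorbit u).
Proof.
have e : Urep (Ul a) = (lact a : A) by apply: U_lift_l.
have eM : Urep (Ul a * u) = (lact a : A) * Urep u by rewrite rmorphM -e.
exact: (congr1 (fun f : A => (f : {linear V -> V}) v0) eM).
Qed.

Lemma Uorbit_r a u : Uorbit (Ur a * u) = ract a (Uorbit u).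
Proof.
have e : Urep (Ur a) = (ract a : A) by apply: U_lift_r.
have eM : Urep (Ur a * u) = (ract a : A) * Urep u by rewrite rmorphM -e.
exact: (congr1 (fun f : A => (f : {linear V -> V}) v0) eM).
Qed.

End UAction.

(** * Linearity of pure tensors in each factor *)

Section PureTensors.
Variables (k : fieldType) (V W : lmodType k).

HB.instance Definition _ (v : V) := GRing.isLinear.Build k W (tens V W) *:%R
  (tpure v) (fun c w w' => tpurePr c v w w').

Definition tpure_flip (w : W) (v : V) : tens V W := tpure v w.

HB.instance Definition _ (w : W) := GRing.isLinear.Build k V (tens V W) *:%R
  (tpure_flip w) (fun c v v' => tpurePl c v v' w).

Lemma tpureDl (v v' : V) (w : W) : tpure (v + v') w = tpure v w + tpure v' w.
Proof. exact: (linearD (tpure_flip w)). Qed.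

Lemma tpureDr (v : V) (w w' : W) : tpure v (w + w') = tpure v w + tpure v w'.
Proof. exact: linearD. Qed.

Lemma tpureBl (v v' : V) (w : W) : tpure (v - v') w = tpure v w - tpure v' w.
Proof. exact: (linearB (tpure_flip w)). Qed.

Lemma tpure0l (w : W) : tpure 0 w = 0 :> tens V W.
Proof. exact: (linear0 (tpure_flip w)). Qed.

End PureTensors.

(** * The [U(L)]-module structure on [T(L) (x) S(L)] *)

Section Operators.
Variables (k : fieldType) (L : preLieType k).
Local Notation T := (Tmod L).
Local Notation S := (Smod L).

Definition tcons a : {linear T -> T} :=
  Tlift (multilinear_cons a (@tw_multilinear k L)).

Lemma tconsE a w : tcons a (tw w) = tw (a :: w).
Proof. exact: TliftE. Qed.

(** The derivation [D_b]: the parameter [e = 1] supplies the term [- a b], which [sder] drops with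
    [e = 0]. *)
Definition tder b : {linear T -> T} :=
  Tlift (insder_multilinear 1 b (@tw_multilinear k L)).

Lemma tderE b w : tder b (tw w) = insder 1 (@tw k L) b w.
Proof. exact: TliftE. Qed.

Lemma Tmod_linear_param (E : lmodType k) (F : L -> {linear T -> E}) :
  (forall w, linear (fun a => F a (tw w))) -> forall t, linear (F^~ t).
Proof.
move=> FL t c a b; move: t.
apply: (Tmod_linear_ext (f := F (c *: a + b)) (g := c \*: F a \+ F b)) => w.
exact: FL.
Qed.

Lemma tcons_linear t : linear (tcons^~ t).
Proof.
move: t; apply: Tmod_linear_param => w c a b; rewrite !tconsE.
exact: (@tw_multilinear k L [::]).
Qed.

Lemma tder_linear t : linear (tder^~ t).
Proof.
move: t; apply: Tmod_linear_param => w c a b; rewrite !tderE.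
by apply: insder_linear; apply: tw_multilinear.
Qed.

(** The Leibniz rule for [D_b]; it is the relation between [r_b] and [l_a] on the tensor factor. *)
Lemma tder_tcons b a t :
  tder b (tcons a t) = tcons (prelie a b) t - tcons a (tcons b t) + tcons a (tder b t).
Proof.
move: t; apply: (Tmod_linear_ext (f := tder b \o tcons a)
  (g := tcons (prelie a b) \- (tcons a \o tcons b) \+ (tcons a \o tder b))) => w.
rewrite /= !tconsE !tderE insder_linear_comp /= scale1r.
by congr (_ + _); apply: eq_insder => v; rewrite tconsE.
Qed.

Lemma tder_comm b c t : tder c (tder b t) + tder (prelie c b) t
  = tder b (tder c t) + tder (prelie b c) t.
Proof.
move: t; apply: (Tmod_linear_ext (f := (tder c \o tder b) \+ tder (prelie c b))
  (g := (tder b \o tder c) \+ tder (prelie b c))) => w /=.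
rewrite !tderE !insder_linear_comp.
rewrite (eq_insder _ _ _ (tderE c)) (eq_insder _ _ _ (tderE b)).
by apply: insder_comm; apply: tw_multilinear.
Qed.

Lemma sw_cons_swap_invariant b : swap_invariant (fun w => sw (b :: w) : S).
Proof. by move=> s1 x y s2; apply: (sw_swap_invariant (b :: s1)). Qed.

Definition smul b : {linear S -> S} :=
  Slift (multilinear_cons b (@sw_multilinear k L)) (sw_cons_swap_invariant b).

Lemma smulE b w : smul b (sw w) = sw (b :: w).
Proof. exact: SliftE. Qed.

Definition sder b : {linear S -> S} :=
  Slift (insder_multilinear 0 b (@sw_multilinear k L))
        (insder0_swap_invariant b (@sw_swap_invariant k L)).

Lemma sderE b w : sder b (sw w) = insder 0 (@sw k L) b w.
Proof. exact: SliftE. Qed.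

Lemma sder_smul b a s : sder b (smul a s) = smul (prelie a b) s + smul a (sder b s).
Proof.
move: s; apply: (Smod_linear_ext (f := sder b \o smul a)
  (g := smul (prelie a b) \+ (smul a \o sder b))) => w.
rewrite /= !smulE !sderE insder_linear_comp /= scale0r subr0.
by congr (_ + _); apply: eq_insder => v; rewrite smulE.
Qed.

Lemma sder_comm b c s : sder c (sder b s) + sder (prelie c b) s
  = sder b (sder c s) + sder (prelie b c) s.
Proof.
move: s; apply: (Smod_linear_ext (f := (sder c \o sder b) \+ sder (prelie c b))
  (g := (sder b \o sder c) \+ sder (prelie b c))) => w /=.
rewrite !sderE !insder_linear_comp.
rewrite (eq_insder _ _ _ (sderE c)) (eq_insder _ _ _ (sderE b)).
by apply: insder_comm; apply: sw_multilinear.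
Qed.

Lemma smulC a b s : smul a (smul b s) = smul b (smul a s).
Proof.
move: s; apply: (Smod_linear_ext (f := smul a \o smul b)
  (g := smul b \o smul a)) => w; rewrite /= !smulE.
exact: (@sw_swap_invariant k L [::]).
Qed.

Definition sact b : {linear S -> S} := smul b \+ sder b.

Lemma sactE b s : sact b s = smul b s + sder b s.
Proof. by []. Qed.

Lemma sact_linear s : linear (sact^~ s).
Proof.
move=> c a b; move: s.
apply: (Smod_linear_ext (f := sact (c *: a + b)) (g := c \*: sact a \+ sact b)) => w.
have lin : linear (fun x => smul x (sw w) + sder x (sw w)).
  apply: linear_funD => c' x y.
    by rewrite !smulE; apply: (@sw_multilinear k L [::]).
  by rewrite !sderE; apply: insder_linear; apply: sw_multilinear.
exact: lin.
Qed.

(** Multiplications commute, derivations obey [sder_comm], and the Leibniz term [(b <| c) s] pairs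
    with the multiplication by [c <| b] to a symmetric sum. *)
Lemma sact_comm b c s : sact c (sact b s) + sact (prelie c b) s
  = sact b (sact c s) + sact (prelie b c) s.
Proof.
have step b' c' : sact c' (sact b' s) + sact (prelie c' b') s
  = (sder c' (sder b' s) + sder (prelie c' b') s) + smul c' (smul b' s)
    + (smul c' (sder b' s) + smul b' (sder c' s))
    + (smul (prelie b' c') s + smul (prelie c' b') s).
  by rewrite !sactE !linearD sder_smul; sum_ac.
rewrite !step sder_comm (smulC c b).
by rewrite (addrC (smul c (sder b s))) (addrC (smul (prelie b c) s)).
Qed.

Local Notation V := (tens T S).

Definition lop a : {linear V -> V} := tens_map (tcons a) (idfun : {linear S -> S}).
Definition rop b : {linear V -> V} :=
  tens_map (tder b) (idfun : {linear S -> S})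
  \+ tens_map (idfun : {linear T -> T}) (sact b).

Lemma lopE a t s : lop a (tpure t s) = tpure (tcons a t) s.
Proof. exact: tens_mapE. Qed.

Lemma ropE b t s : rop b (tpure t s) = tpure (tder b t) s + tpure t (sact b s).
Proof.
have e (f g : {linear V -> V}) v : (f \+ g) v = f v + g v by [].
by rewrite [LHS]e !tens_mapE.
Qed.

Fact lop_linear v : linear (lop^~ v).
Proof.
move=> c a b; move: v.
apply: (tens_linear_ext (f := lop (c *: a + b)) (g := c \*: lop a \+ lop b)) => t s.
rewrite -[RHS]/(c *: lop a (tpure t s) + lop b (tpure t s)) !lopE.
by rewrite tcons_linear tpurePl.
Qed.

Fact rop_linear v : linear (rop^~ v).
Proof.
move=> c a b; move: v.
apply: (tens_linear_ext (f := rop (c *: a + b)) (g := c \*: rop a \+ rop b)) => t s.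
rewrite -[RHS]/(c *: rop a (tpure t s) + rop b (tpure t s)) !ropE.
by rewrite tder_linear sact_linear tpurePl tpurePr scalerDr addrACA.
Qed.

(** The two summands of [rop] act on different factors: the mixed terms are symmetric in [a] and
    [b], and the rest is [tder_comm] on one factor and [sact_comm] on the other. *)
Fact rop_rop a b v :
  rop b (rop a v) - rop (prelie a b) v = rop a (rop b v) - rop (prelie b a) v.
Proof.
apply: eq_add_sub; move: v.
apply: (tens_linear_ext (f := (rop b \o rop a) \+ rop (prelie b a))
  (g := (rop a \o rop b) \+ rop (prelie a b))) => t s.
have step a' b' : rop b' (rop a' (tpure t s)) + rop (prelie b' a') (tpure t s)
  = tpure (tder b' (tder a' t) + tder (prelie b' a') t) s
    + tpure t (sact b' (sact a' s) + sact (prelie b' a') s)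
    + (tpure (tder a' t) (sact b' s) + tpure (tder b' t) (sact a' s)).
  rewrite !ropE (linearD (rop b')) !ropE tpureDl (tpureDr t (sact b' _)).
  have ac (M : zmodType) (m n p q x y : M) :
    m + n + (p + q) + (x + y) = (m + x) + (q + y) + (n + p) by sum_ac.
  exact: ac.
rewrite [LHS]step [RHS]step tder_comm sact_comm.
by rewrite (addrC (tpure (tder a t) (sact b s))).
Qed.

(** [1 (x) N_b] commutes with [l_a], so only [D_b] contributes to the commutator, through
    [tder_tcons]. *)
Fact rop_lop a b v :
  rop b (lop a v) - lop a (rop b v) = lop (prelie a b) v - lop a (lop b v).
Proof.
apply: eq_add_sub; move: v.
apply: (tens_linear_ext (f := (rop b \o lop a) \+ (lop a \o lop b))
  (g := lop (prelie a b) \+ (lop a \o rop b))) => t s.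
rewrite -[LHS]/(rop b (lop a (tpure t s)) + lop a (lop b (tpure t s))).
rewrite -[RHS]/(lop (prelie a b) (tpure t s) + lop a (rop b (tpure t s))).
rewrite ropE !lopE ropE (linearD (lop a)) !lopE tder_tcons tpureDl tpureBl.
have ac (M : zmodType) (m n p q : M) : m - n + p + q + n = m + (p + q).
  by rewrite addrC !addrA (addrC n) addrK -addrA.
exact: ac.
Qed.

Definition vac : V := tpure (tw [::]) (sw [::]).

Lemma Psi_vac : Psi L vac = 1.
Proof. by rewrite PsiE psiTE psiSE mulr1 /lprod big_nil. Qed.

(** [Psi] sends [vac] to the unit of [U(L)], which is nonzero. This gives the nonzero vector
    required by the endomorphism algebra behind [Phi]. *)
Fact vac_neq0 : vac != 0.
Proof.
apply/eqP=> v0; have := oner_neq0 (UPreLie L).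
by rewrite -Psi_vac v0 linear0 eqxx.
Qed.

Definition Phi : {linear UPreLie L -> V} :=
  Uorbit vac_neq0 lop_linear rop_linear rop_rop rop_lop.

Lemma Phi1 : Phi 1 = vac.
Proof. exact: Uorbit1. Qed.
Lemma Phi_l a u : Phi (Ul a * u) = lop a (Phi u).
Proof. exact: Uorbit_l. Qed.
Lemma Phi_r a u : Phi (Ur a * u) = rop a (Phi u).
Proof. exact: Uorbit_r. Qed.

End Operators.

(** * [Phi] and [Psi] are mutually inverse *)

Section Inverse.
Variables (k : fieldType) (L : preLieType k).

Lemma TS_linear_ext (E : lmodType k) (f g : {linear tens (Tmod L) (Smod L) -> E}) :
  (forall w v, f (tpure (tw w) (sw v)) = g (tpure (tw w) (sw v))) -> f =1 g.
Proof.
move=> fg; apply: tens_linear_ext => t s; move: t.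
apply: (Tmod_linear_ext (f := f \o tpure_flip s) (g := g \o tpure_flip s)) => w.
rewrite -[LHS]/(f (tpure (tw w) s)) -[RHS]/(g (tpure (tw w) s)); move: s.
apply: (Smod_linear_ext (f := f \o tpure (tw w)) (g := g \o tpure (tw w))) => v.
exact: fg.
Qed.

Lemma lprod_cons (a : L) w : lprod (a :: w) = Ul a * lprod w.
Proof. exact: big_cons. Qed.

Lemma psiT_tcons (a : L) t : psiT L (tcons a t) = Ul a * psiT L t.
Proof.
move: t; apply: (Tmod_linear_ext (f := psiT L \o tcons a)
  (g := Umull (Ul a) \o psiT L)) => w.
rewrite -[LHS]/(psiT L (tcons a (tw w))) -[RHS]/(Ul a * psiT L (tw w)).
by rewrite tconsE !psiTE lprod_cons.
Qed.

(** The product of the [l]'s turns [D_b] into the commutator with [r_b]: on one letter this is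
    [Url], and both sides obey the Leibniz rule. *)
Lemma insder_lprod (b : L) w :
  insder 1 (@lprod k L) b w = Ur b * lprod w - lprod w * Ur b.
Proof.
elim: w => [|x w IH]; first by rewrite /lprod big_nil mulr1 mul1r subrr.
rewrite [LHS]/= (eq_insder _ _ _ (lprod_cons x)) insder_mull IH scale1r.
rewrite !lprod_cons mulrBr !mulrA.
have -> : Ur b * Ul x = Ul x * Ur b + (Ul (prelie x b) - Ul x * Ul b).
  by rewrite -Url addrC subrK.
by rewrite 2!mulrDl mulNr addrA (addrC (Ul x * Ur b * _)).
Qed.

Lemma psiT_tder (b : L) t :
  psiT L (tder b t) = Ur b * psiT L t - psiT L t * Ur b.
Proof.
move: t; apply: (Tmod_linear_ext (f := psiT L \o tder b)
  (g := (Umull (Ur b) \o psiT L) \- (Umulr (Ur b) \o psiT L))) => w.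
rewrite -[LHS]/(psiT L (tder b (tw w))).
rewrite -[RHS]/(Ur b * psiT L (tw w) - psiT L (tw w) * Ur b).
rewrite tderE insder_linear_comp (eq_insder _ _ _ (@psiTE k L)) psiTE.
exact: insder_lprod.
Qed.

(** The recursion [psi_cons] read as [psi(b s + s <| b) = r_b psi(s)]. *)
Lemma psiS_sact (b : L) s : psiS L (sact b s) = Ur b * psiS L s.
Proof.
move: s; apply: (Smod_linear_ext (f := psiS L \o sact b)
  (g := Umull (Ur b) \o psiS L)) => w.
rewrite -[LHS]/(psiS L (sact b (sw w))) -[RHS]/(Ur b * psiS L (sw w)).
rewrite sactE linearD smulE sderE insder_linear_comp.
rewrite (eq_insder _ _ _ (@psiSE k L)) !psiSE psi_cons.
by rewrite subrK.
Qed.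

Lemma Psi_lop (a : L) v : Psi L (lop a v) = Ul a * Psi L v.
Proof.
move: v; apply: (tens_linear_ext (f := Psi L \o lop a)
  (g := Umull (Ul a) \o Psi L)) => t s.
rewrite -[LHS]/(Psi L (lop a (tpure t s))) -[RHS]/(Ul a * Psi L (tpure t s)).
by rewrite lopE !PsiE mulrA psiT_tcons.
Qed.

(** The commutator coming from [D_b] leaves [- psiT(t) r_b psiS(s)], which the contribution of [N_b]
    cancels. *)
Lemma Psi_rop (b : L) v : Psi L (rop b v) = Ur b * Psi L v.
Proof.
move: v; apply: (tens_linear_ext (f := Psi L \o rop b)
  (g := Umull (Ur b) \o Psi L)) => t s.
rewrite -[LHS]/(Psi L (rop b (tpure t s))) -[RHS]/(Ur b * Psi L (tpure t s)).
rewrite ropE linearD !PsiE psiT_tder psiS_sact mulrBl.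
by rewrite (mulrA (psiT L t)) subrK mulrA.
Qed.

(** Both maps respect the action of the generators, so agreement with the identity propagates from
    [1]. *)
Lemma PhiK : cancel (@Phi k L) (Psi L).
Proof.
apply: (UPreLie_linear_ext (f := Psi L \o @Phi k L) (g := idfun)) => [|a u|a u].
- by rewrite -[LHS]/(Psi L (Phi L 1)) Phi1 Psi_vac.
- move=> e.
  by rewrite -[LHS]/(Psi L (Phi L (Ul a * u))) Phi_l Psi_lop (e : Psi L (Phi L u) = u).
- move=> e.
  by rewrite -[LHS]/(Psi L (Phi L (Ur a * u))) Phi_r Psi_rop (e : Psi L (Phi L u) = u).
Qed.

(** The correction term of [psi] cancels the derivation part of [N_b]: [r_b psi(w) - psi(w <| b)]
    goes to [1 (x) (b w + w <| b) - 1 (x) (w <| b)]. *)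
Lemma Phi_psi (w : seq L) : Phi L (psi (size w) w) = tpure (tw [::]) (sw w).
Proof.
(* Induction on the length, because the words of [w <| b] are not subwords of [b :: w]. *)
move: {2}(size w) (erefl (size w)) => n; elim: n w => [|n IH] [|b w] // wn.
  exact: Phi1.
case: wn => wn; rewrite [size _]/= psi_cons linearB Phi_r IH //.
rewrite insder_linear_comp.
rewrite (eq_insder0_size (h' := fun v => tpure (tw [::]) (sw v))); last first.
  by move=> v vw; rewrite IH // vw.
(* [D_b] kills the empty word, so only [1 (x) N_b] remains. *)
rewrite -insder_linear_comp -sderE ropE tderE tpure0l add0r.
by rewrite sactE tpureDr addrK smulE.
Qed.

Lemma PsiK : cancel (Psi L) (@Phi k L).
Proof.
apply: (TS_linear_ext (f := @Phi k L \o Psi L) (g := idfun)) => w v.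
rewrite -[LHS]/(Phi L (Psi L (tpure (tw w) (sw v)))) PsiE psiTE psiSE.
rewrite -[RHS]/(tpure (tw w) (sw v)).
(* Each letter of [w] is a factor [l_a], which [Phi] turns into [lop a]; the symmetric factor is
   left for the base case. *)
elim: w => [|a w IH]; first by rewrite /lprod big_nil mul1r Phi_psi.
by rewrite lprod_cons -mulrA Phi_l IH lopE tconsE.
Qed.

End Inverse.

(** * Naturality in [L] *)

Section Naturality.
Variables (k : fieldType) (L L' : preLieType k) (f : preLieHom L L').

Lemma insder_map e (E : lmodType k) (h : seq L' -> E) b w :
  insder e h (f b) (map f w) = insder e (fun v => h (map f v)) b w.
Proof. by elim: w h => //= x w IH h; rewrite IH plhomM. Qed.

(** [psi] is built from the [r]'s and the pre-Lie product, and [f] respects both. *)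
Lemma psi_map n w : psi n (map f w) = UPreLie_map f (psi n w).
Proof.
elim: n w => [|n IH] [|b w]; rewrite ?rmorph1 ?rmorph0 //.
have step u v : UPreLie_map f (Ur b * u - v)
    = Ur (f b) * UPreLie_map f u - UPreLie_map f v.
  by rewrite linearB -UPreLie_map_r -rmorphM.
rewrite -[psi n.+1 (b :: w)]/(Ur b * psi n w - insder 0 (psi n) b w) step -IH.
rewrite (insder_linear_comp 0 (UPreLie_map f)) -(eq_insder _ _ _ IH) -insder_map.
by [].
Qed.

Lemma lprod_map w : lprod (map f w) = UPreLie_map f (lprod w).
Proof.
rewrite /lprod big_map rmorph_prod; apply: eq_bigr => a _.
exact/esym/UPreLie_map_l.
Qed.

(** Naturality is proved first in this direction because [Psi] is explicit on words. *)
Lemma Psi_natural x :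
  Psi L' (tens_map (Tmod_map f) (Smod_map f) x) = UPreLie_map f (Psi L x).
Proof.
move: x; apply: (TS_linear_ext
  (f := Psi L' \o tens_map (Tmod_map f) (Smod_map f))
  (g := UPreLie_map f \o Psi L)) => w v.
rewrite -[LHS]/(Psi L' (tens_map _ _ (tpure (tw w) (sw v)))).
rewrite -[RHS]/(UPreLie_map f (Psi L (tpure (tw w) (sw v)))).
rewrite tens_mapE Tmod_map_tw Smod_map_sw !PsiE !psiTE !psiSE rmorphM.
by rewrite lprod_map size_map psi_map.
Qed.

End Naturality.

Theorem theorem2 (k : fieldType) (char0 : [pchar k] =i pred0) :
  exists phi : forall L : preLieType k,
      {linear UPreLie L -> tens (Tmod L) (Smod L)},
    (forall L : preLieType k, bijective (phi L)) /\
    (forall (L L' : preLieType k) (f : preLieHom L L') (u : UPreLie L),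
        phi L' (UPreLie_map f u)
        = tens_map (Tmod_map f) (Smod_map f) (phi L u)).
Proof.
exists (@Phi k); split=> [L|L L' f u].
  by exists (Psi L); [apply: PhiK | apply: PsiK].
(* Writing [u] as the image under [Psi] of [Phi L u] passes naturality from [Psi] to its inverse. *)
by rewrite -{1}(PhiK u) -Psi_natural PsiK.
Qed.
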